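(* Fix $\delta > 0$ and a constant $A>0$. Let $h, k \in \mathbb N$ with $k \le A(\log h)^{1-\delta}$. Define \[ T_k(h) := \sum_{\substack{h_1, \dots, h_k \le h \\ \text{distinct}}} \mathfrak S(\{h_1, \dots, h_k\}), \] the sum running over ordered $k$-tuples of distinct positive integers $h_1,\dots,h_k\le h$. Then there exists $\beta > 0$, depending only on $\delta$, such that \[ T_k(h) = h^k + O(h^{k-\beta}), \] as $h\to\infty$ (the implied constant depending on $\delta$ and $A$).
   Context: For a finite set $\mathcal H = \{h_1,\dots,h_k\}$ of $k$ distinct integers, $\nu_{\mathcal H}(p)$ denotes the number of distinct residue classes modulo the prime $p$ occupied by the elements of $\mathcal H$, and the singular series is \[ \mathfrak S(\mathcal H) = \prod_{p \text{ prime}} \frac{1-\nu_{\mathcal H}(p)/p}{(1-1/p)^k}. \] *)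

(* Defs.v *)
From mathcomp Require Import all_boot all_order all_algebra finmap.
From mathcomp Require Import all_classical all_reals all_analysis.

Set Implicit Arguments.
Unset Strict Implicit.
Unset Printing Implicit Defensive.

Import Order.TTheory GRing.Theory Num.Theory.
Import numFieldNormedType.Exports.

Local Open Scope ring_scope.
Local Open Scope fset_scope.

Definition nu (H : {fset int}) (p : nat) : nat :=
  #|` [fset (x %% p)%Z | x in H] |.

Definition singular_factor (R : realType) (H : {fset int}) (p : nat) : R :=
  (1 - (nu H p)%:R / p%:R) / (1 - p%:R^-1) ^+ #|` H |.

(* The infinite product is the limit of its partial products over the primes
   below N; as nu H p = #|` H | for all large p, the factors are 1 + O(1/p^2)
   and this limit exists for every H. *)
Definition singular_series (R : realType) (H : {fset int}) : R :=
  limn (fun N : nat => \prod_(0 <= p < N | prime p) singular_factor R H p).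

(* A tuple (h_1, ..., h_k) of distinct elements of {1, ..., h} is encoded by an
   injective f : 'I_k -> 'I_h, with entries (f i).+1. *)
Definition T (R : realType) (k h : nat) : R :=
  \sum_(f : {ffun 'I_k -> 'I_h} | injectiveb f)
    singular_series R [fset (f i).+1%:Z | i in 'I_k].

(* Main.v *)
Require Import Defs.
From mathcomp Require Import all_boot all_order all_algebra finmap.
From mathcomp Require Import all_classical all_reals all_analysis.
From mathcomp Require Import fintype finset zify ring lra.

Set Implicit Arguments.
Unset Strict Implicit.
Unset Printing Implicit Defensive.

Import Order.TTheory GRing.Theory Num.Theory.
Import numFieldNormedType.Exports.

(** With [b_p = (1 - nu_p / p) / (1 - 1 / p) ^ k], the product of [b_p] over a
    finite set of primes with product [m] much smaller than [h / k] has average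
    nearly 1 over all [k]-tuples, since averaging it amounts to taking the [k]-th
    moment of sifted intervals of length [h].  Let [z = (ln h) ^ (1 - s)], so that the primes up
    to [z] have product [h ^ o(1)].  Over the primes beyond [z], expand the
    product of [1 + (b_p - 1)] into squarefree [q].  The terms with
    [q <= h ^ (1 / 4)] average to 0 for [q > 1] by inclusion-exclusion.  The
    others are bounded by Rankin's trick together with
    [|b_p - 1| <= 2 d / p + k ^ 2 / p ^ 2], where [d = k - nu_p] counts
    collisions modulo [p].  Since [k] is at most a constant times
    [(ln h) ^ (1 - 4 s)], collisions are rare enough on average for the
    resulting product to be [h ^ o(1)]. *)

(** * Counting residues *)

(** The map from [n] to its two residues is injective by the Chinese remainder theorem, hence
    bijective by cardinality, and the double sum factorizes. *)
Lemma sum_crt (m1 m2 : nat) (P1 P2 : pred nat) : coprime m1 m2 ->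
  (\sum_(n < m1 * m2) (P1 (n %% m1) && P2 (n %% m2)) =
   (\sum_(a < m1) P1 a) * (\sum_(b < m2) P2 b))%N.
Proof.
move=> co.
have [->|m1_gt0] := posnP m1; first by rewrite mul0n !big_ord0.
have [->|m2_gt0] := posnP m2; first by rewrite muln0 !big_ord0 muln0.
pose g (n : 'I_(m1 * m2)) : 'I_m1 * 'I_m2 :=
  (Ordinal (ltn_pmod n m1_gt0), Ordinal (ltn_pmod n m2_gt0)).
have g_inj : injective g.
  move=> x y [e1 e2]; apply/val_inj => /=.
  have := chinese_remainder co x y; rewrite e1 e2 !eqxx /=.
  by rewrite !modn_small // => /eqP.
have g_bij : bijective g by apply: inj_card_bij => //; rewrite card_prod !card_ord.
rewrite big_distrlr /= pair_big /= (reindex g); last exact: onW_bij.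
by apply: eq_bigr => n _; rewrite /= mulnb.
Qed.

Lemma coprime_prod_primes (q : nat) (U : seq nat) :
  prime q -> all prime U -> q \notin U -> coprime q (\prod_(p <- U) p).
Proof.
move=> pq pU qU; rewrite big_seq.
apply: (big_ind (coprime q)) => [|x y|p pIU]; first exact: coprimen1.
  by rewrite coprimeMr => -> ->.
rewrite prime_coprime // dvdn_prime2 //; last exact: (allP pU).
by apply: contraNneq qU => ->.
Qed.

Lemma eq_mod_prod_primes (U : seq nat) (x y : nat) :
  uniq U -> all prime U -> all (fun p => x == y %[mod p]) U ->
  x == y %[mod \prod_(p <- U) p].
Proof.
elim: U => [|q U IH] /=; first by rewrite big_nil !modn1.
move=> /andP[qU uU] /andP[pq pU] /andP[xy xyU]; rewrite big_cons.
by rewrite chinese_remainder ?xy ?IH // coprime_prod_primes.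
Qed.

(** Induction on [U], splitting off the head prime with [sum_crt]; residues modulo the remaining
    primes survive reduction modulo their product. *)
Lemma sum_crt_seq (U : seq nat) (P : nat -> pred nat) :
  uniq U -> all prime U ->
  (\sum_(n < \prod_(p <- U) p) all (fun p => P p (n %% p)) U =
   \prod_(p <- U) \sum_(r < p) P p r)%N.
Proof.
elim: U => [|q U IH] /=; first by rewrite !big_nil big_ord1.
move=> /andP[qU uU] /andP[pq pU]; rewrite !big_cons -IH //.
have co := coprime_prod_primes pq pU qU.
rewrite -(sum_crt (P q) (fun n => all (fun p => P p (n %% p)) U) co).
apply: eq_bigr => n _; congr (nat_of_bool (_ && _)).
apply: eq_in_all => p pU'; rewrite modn_dvdm //.
by rewrite (big_rem p) //= dvdn_mulr.
Qed.

(** The interval below [h] contains [h %/ m] full periods and is covered by one more. *)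
Lemma sum_periodic (m : nat) (P : pred nat) (h : nat) :
  (0 < m)%N -> (forall n, P (n + m) = P n)%N ->
  ((h %/ m) * (\sum_(n < m) P n) <= \sum_(n < h) P n <=
   (h %/ m).+1 * (\sum_(n < m) P n))%N.
Proof.
move=> m_gt0 per.
have perM a n : P (n + a * m)%N = P n.
  by elim: a => [|a IH]; rewrite ?mul0n ?addn0 // mulSn addnCA addnC per.
have full a : (\sum_(n < a * m) P n = a * \sum_(n < m) P n)%N.
  elim: a => [|a IH]; first by rewrite !mul0n big_ord0.
  rewrite [in LHS]mulSnr big_split_ord /= IH mulSnr; congr addn.
  by apply: eq_bigr => i _; rewrite addnC perM.
have mono a b : (a <= b)%N -> (\sum_(n < a) P n <= \sum_(n < b) P n)%N.
  by move=> /subnKC <-; rewrite big_split_ord /= leq_addr.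
rewrite -!full; apply/andP; split; apply: mono; first exact: leq_trunc_div.
by rewrite ltnW // ltn_ceil.
Qed.

(** This is [nu] of the tuple (see [nu_occ]), with residues taken in ['I_p] so that the missed
    classes can be counted as a complement. *)
Definition occ (k h : nat) (f : {ffun 'I_k -> 'I_h}) (p : nat) : nat :=
  #|[set r : 'I_p | [exists i, (f i).+1 %% p == r]]|.

Lemma occ_complement (k h : nat) (f : {ffun 'I_k -> 'I_h}) (p : nat) :
  (\sum_(r < p) [forall i, (f i).+1 %% p != r] = p - occ f p)%N.
Proof.
rewrite (eq_bigr (fun r : 'I_p => if r \in ~: [set r : 'I_p | [exists i, (f i).+1 %% p == r]] then 1 else 0)%N); last first.
  by move=> r _; rewrite !inE negb_exists; case: [forall _, _].
by rewrite -big_mkcond /= sum1_card cardsCs setCK card_ord.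
Qed.

Lemma occ_le (k h : nat) (f : {ffun 'I_k -> 'I_h}) (p : nat) : (occ f p <= p)%N.
Proof. by rewrite -[X in (_ <= X)%N]card_ord max_card. Qed.

Lemma sum_shift_residue (p n : nat) : (0 < p)%N ->
  (\sum_(r < p) (r.+1 %% p != n %% p) = p.-1)%N.
Proof.
(* The only excluded [r] is [n - 1] modulo [p], written with [p.-1] to avoid truncated
   subtraction. *)
move=> p_gt0; pose r0 := Ordinal (ltn_pmod (n + p.-1) p_gt0).
have E (r : 'I_p) : (r.+1 %% p == n %% p)%N = (r == r0).
  have -> : (r == r0) = (r == n + p.-1 %[mod p])%N.
    by rewrite -val_eqE /= (modn_small (ltn_ord r)).
  by rewrite -(eqn_modDr p.-1) addSnnS prednK // modnDr.
rewrite (eq_bigr (fun r : 'I_p => if r \in [set~ r0] then 1 else 0)%N); last first.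
  by move=> r _; rewrite E !inE; case: eqP.
by rewrite -big_mkcond /= sum1_card cardsC1 card_ord.
Qed.

Lemma occ_imset (k h : nat) (f : {ffun 'I_k -> 'I_h}) (p : nat) (p0 : (0 < p)%N) :
  occ f p = #|[set Ordinal (ltn_pmod (f i).+1 p0) | i : 'I_k]|.
Proof.
congr #|pred_of_set _|; apply/setP => r; rewrite inE.
apply/existsP/imsetP => [[i /eqP ri]|[i _ ->]]; last by exists i.
by exists i => //; apply/val_inj.
Qed.

Lemma occ_le_card (k h : nat) (f : {ffun 'I_k -> 'I_h}) (p : nat) :
  (0 < p)%N -> (occ f p <= k)%N.
Proof.
by move=> p0; rewrite (occ_imset f p0) (leq_trans (leq_imset_card _ _)) ?card_ord.
Qed.

Lemma occ_distinct (k h : nat) (f : {ffun 'I_k -> 'I_h}) (p : nat) :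
  injective f -> (h < p)%N -> occ f p = k.
Proof.
move=> fI hp; have p0 : (0 < p)%N by lia.
rewrite (occ_imset f p0) card_imset ?card_ord // => i j /(congr1 val) /=.
rewrite !modn_small; last 2 first.
- exact: leq_ltn_trans (ltn_ord (f j)) hp.
- exact: leq_ltn_trans (ltn_ord (f i)) hp.
by move=> [] /val_inj /fI.
Qed.

(** Indices that collide with no other index have pairwise distinct residues, so the missing classes
    are at most as many as the colliding indices. *)
Lemma occ_collisions (k h : nat) (f : {ffun 'I_k -> 'I_h}) (p : nat) :
  (0 < p)%N ->
  (k - occ f p <=
   #|[set j : 'I_k | [exists i, (i != j) && (f i == f j %[mod p])]]|)%N.
Proof.
move=> p0; set B := [set j | _]; rewrite (occ_imset f p0).
pose r (i : 'I_k) := Ordinal (ltn_pmod (f i).+1 p0).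
have rI : {in ~: B &, injective r}.
  move=> i j _; rewrite !inE negb_exists => /forallP/(_ i).
  rewrite negb_and negbK => /orP[/eqP //|].
  move=> /negP fij /(congr1 val) /= /eqP; rewrite -addn1 -[in X in _ == X]addn1.
  by rewrite eqn_modDr.
rewrite leq_subLR addnC -[X in (X <= _)%N]card_ord -(cardsC B) leq_add2l.
rewrite -(card_in_imset rI); apply/subset_leq_card/subsetP => _ /imsetP[i _ ->].
by apply/imsetP; exists i.
Qed.

(** The class of [y] has at most [h %/ m + 1] members below [h], and discarding [y] itself removes
    the extra 1. The bound is thus 0 once [m > h], which keeps sums over large moduli under
    control. *)
Lemma count_congruent (h m : nat) (y : 'I_h) : (0 < m)%N ->
  (#|[set x : 'I_h | (x != y) && (x == y %[mod m])]| <= h %/ m)%N.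
Proof.
move=> m0.
have /andP[_] := sum_periodic (P := fun n => n == y %[mod m]) h m0 (fun n =>
  congr1 (fun n' => n' == y %% m) (modnDr n m)).
rewrite (_ : \sum_(n < m) _ = 1) ?muln1; last first.
  pose r := Ordinal (ltn_pmod y m0).
  rewrite (bigD1 r) //= modn_mod eqxx big1 // => n nr.
  by rewrite (modn_small (ltn_ord n)) -[_ == _]/(n == r) (negbTE nr).
rewrite (bigD1 y) //= eqxx add1n ltnS; apply: leq_trans.
rewrite -sum1_card big_mkcond [leqRHS]big_mkcond /=; apply: leq_sum => x _.
by rewrite inE; case: (x != y); case: (x == y %[mod m]).
Qed.

(** * Averages over tuples *)

(** By [sum_crt_seq] the product counts the [n] whose class is missed by the tuple modulo every [p]
    in [U]. The indicator is a product over [i] so that a sum over [f] will factorize. *)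
Lemma prod_occ (k h : nat) (f : {ffun 'I_k -> 'I_h}) (U : seq nat) :
  uniq U -> all prime U ->
  (\prod_(p <- U) (p - occ f p) =
   \sum_(n < \prod_(p <- U) p)
     \prod_i all (fun p => (f i).+1 %% p != n %% p) U)%N.
Proof.
move=> uU pU; rewrite (eq_bigr _ (fun p _ => esym (occ_complement f p))).
rewrite -(sum_crt_seq (fun p r => [forall i, (f i).+1 %% p != r])) //.
apply: eq_bigr => n _.
have -> : (\prod_i all (fun p => (f i).+1 %% p != n %% p) U)%N =
          [forall i, all (fun p => (f i).+1 %% p != n %% p) U].
  case: forallP => [H|/forallP]; first by rewrite big1 // => i _; rewrite H.
  rewrite negb_forall => /existsP[i /negbTE Hi].
  by rewrite (bigD1 i) //= Hi.
congr nat_of_bool; apply/allP/forallP => H.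
  by move=> i; apply/allP => p /H /forallP.
by move=> p pU'; apply/forallP => i; have /allP := H i; apply.
Qed.

Lemma sum_prod_occ (k h : nat) (U : seq nat) : uniq U -> all prime U ->
  (\sum_(f : {ffun 'I_k -> 'I_h}) \prod_(p <- U) (p - occ f p) =
   \sum_(n < \prod_(p <- U) p)
     (\sum_(j < h) all (fun p => j.+1 %% p != n %% p) U) ^ k)%N.
Proof.
move=> uU pU; rewrite (eq_bigr _ (fun f _ => prod_occ f uU pU)).
rewrite exchange_big /=; apply: eq_bigr => n _.
rewrite -(bigA_distr_bigA (fun (_ : 'I_k) (j : 'I_h) =>
  nat_of_bool (all (fun p => j.+1 %% p != n %% p) U))) /=.
by rewrite prod_nat_const card_ord.
Qed.

(** The surviving [j] are periodic modulo the product of [U], and a period has the same number of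
    them for every shift [n]. *)
Lemma sum_sieved (U : seq nat) (n h : nat) : uniq U -> all prime U ->
  (h %/ (\prod_(p <- U) p) * (\prod_(p <- U) p.-1)
    <= \sum_(j < h) all (fun p => j.+1 %% p != n %% p) U
    <= (h %/ (\prod_(p <- U) p)).+1 * (\prod_(p <- U) p.-1))%N.
Proof.
move=> uU pU; set m := (\prod_(p <- U) p)%N; set c := (\prod_(p <- U) p.-1)%N.
have m_gt0 : (0 < m)%N.
  by rewrite /m big_seq; apply: prodn_cond_gt0 => p /(allP pU) /prime_gt0.
have -> : c = (\sum_(j < m) all (fun p => j.+1 %% p != n %% p) U)%N.
  transitivity (\prod_(p <- U) \sum_(r < p) (r.+1 %% p != n %% p))%N.
    rewrite /c !big_seq; apply: eq_bigr => p /(allP pU) /prime_gt0 p_gt0.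
    by rewrite sum_shift_residue.
  rewrite -(sum_crt_seq (fun p r => r.+1 %% p != n %% p)%N) //.
  apply: eq_bigr => j _; congr nat_of_bool; apply: eq_in_all => p _.
  by rewrite -addn1 modnDml addn1.
apply: (sum_periodic (P := fun j => all (fun p => j.+1 %% p != n %% p)%N U)) => // j.
apply: eq_in_all => p pU'.
have /dvdnP[q ->] : p %| m by rewrite /m (big_rem p) //= dvdn_mulr.
by rewrite -addSn addnC modnMDl.
Qed.

Local Open Scope ring_scope.

Lemma bernoulli (R : realFieldType) (t : R) (k : nat) :
  0 <= t <= 1 -> 1 - k%:R * t <= (1 - t) ^+ k.
Proof.
move=> /andP[t0 t1]; elim: k => [|k IH]; first by rewrite expr0 mul0r subr0.
rewrite exprSr; apply: (le_trans _ (ler_wpM2r _ IH)); last by rewrite subr_ge0.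
rewrite -natr1; have : 0 <= k%:R * t * t by rewrite !mulr_ge0.
by lra.
Qed.

Lemma bernoulli_add (R : realFieldType) (t : R) (k : nat) :
  0 <= t -> 1 + k%:R * t <= (1 + t) ^+ k.
Proof.
move=> t0; elim: k => [|k IH]; first by rewrite mul0r addr0.
rewrite exprSr; apply: le_trans (ler_wpM2r _ IH); last by rewrite addr_ge0.
rewrite -natr1; have : 0 <= k%:R * t * t by rewrite !mulr_ge0.
by lra.
Qed.

Lemma bernoulli_upper (R : realFieldType) (t : R) (k : nat) :
  0 <= t -> 2 * k%:R * t <= 1 -> (1 + t) ^+ k <= 1 + 2 * k%:R * t.
Proof.
move=> t0; elim: k => [|k IH] kt; first by rewrite expr0 mulr0 mul0r addr0.
have kt' : 2 * k%:R * t <= 1.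
  by apply: le_trans kt; rewrite ler_wpM2r // ler_wpM2l // ler_nat.
rewrite exprSr; apply: (le_trans (ler_wpM2r _ (IH kt'))); first by lra.
rewrite -natr1; have : 2 * k%:R * t * t <= 1 * t by rewrite ler_wpM2r.
by lra.
Qed.

(** The ratio [y / x] lies within [m / x] of 1, and Bernoulli's inequalities control its k-th power
    on both sides. *)
Lemma exprn_perturb (R : realFieldType) (x y m : R) (k : nat) :
  0 < x -> 0 <= m -> x - m <= y <= x + m -> 2 * k%:R * m <= x -> m <= x ->
  `|y ^+ k - x ^+ k| <= x ^+ k * (2 * k%:R * m / x).
Proof.
move=> x0 m0 /andP[ym yM] km mx.
have t0 : 0 <= m / x by rewrite divr_ge0 // ltW.
have t1 : m / x <= 1 by rewrite ler_pdivrMr // mul1r.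
have kt : 2 * k%:R * (m / x) <= 1 by rewrite mulrA ler_pdivrMr // mul1r.
have xk : 0 <= x ^+ k by rewrite exprn_ge0 // ltW.
have [xN0 y0] : x != 0 /\ 0 <= y.
  by rewrite gt_eqF //; split => //; apply: le_trans ym; rewrite subr_ge0.
have lo : x ^+ k * (1 - k%:R * (m / x)) <= y ^+ k.
  apply: (le_trans (ler_wpM2l xk (bernoulli k _))); first by rewrite t0.
  rewrite -exprMn lerXn2r // ?nnegrE ?mulr_ge0 ?subr_ge0 ?(ltW x0) //.
  by rewrite mulrBr mulr1 mulrCA divff // mulr1.
have hi : y ^+ k <= x ^+ k * (1 + 2 * k%:R * (m / x)).
  apply: (le_trans _ (ler_wpM2l xk (bernoulli_upper t0 kt))).
  rewrite -exprMn lerXn2r // ?nnegrE ?mulr_ge0 ?addr_ge0 ?(ltW x0) //.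
  by rewrite mulrDr mulr1 mulrCA divff // mulr1.
have : 0 <= x ^+ k * (k%:R * (m / x)) by rewrite mulr_ge0 // mulr_ge0.
rewrite -[2 * k%:R * m / x]mulrA ler_norml.
by move=> H; apply/andP; split; lra.
Qed.

(** The exponent is [k] even when [f] is not injective, so that averages over all tuples factorize;
    the value is the singular factor only for injective [f]. *)
Definition fac (R : realFieldType) (k h : nat) (f : {ffun 'I_k -> 'I_h})
  (p : nat) : R := (1 - (occ f p)%:R / p%:R) / (1 - p%:R^-1) ^+ k.

Lemma prod_fac (R : realFieldType) (k h : nat) (f : {ffun 'I_k -> 'I_h})
  (U : seq nat) : all prime U ->
  \prod_(p <- U) fac R f p =
  (\prod_(p <- U) (p - occ f p)%N)%:R / (\prod_(p <- U) p)%:R *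
  ((\prod_(p <- U) p)%:R / (\prod_(p <- U) p.-1)%:R) ^+ k.
Proof.
elim: U => [|p U IH] /=; first by rewrite !big_nil divr1 expr1n mulr1.
move=> /andP[pp pU]; rewrite !big_cons IH // /fac !natrM natrB ?occ_le //.
have p0 : p%:R != 0 :> R by rewrite pnatr_eq0 -lt0n prime_gt0.
have E : 1 - p%:R^-1 = p.-1%:R / p%:R :> R.
  by rewrite -subn1 natrB ?prime_gt0 // mulrBl divff // mul1r.
have -> : 1 - (occ f p)%:R / p%:R = (p%:R - (occ f p)%:R) / p%:R :> R.
  by rewrite mulrBl divff.
have pk0 : p%:R ^+ k != 0 :> R by rewrite expf_neq0.
rewrite E !expr_div_n !exprMn !invfM invrK.
set a := (\prod_(j <- U) (j - occ f j)%N)%:R; set b := (\prod_(j <- U) j)%:R.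
set c := (\prod_(j <- U) j.-1)%:R ^- k; set d := (p.-1)%:R ^- k.
ring.
Qed.

(* Averaging [1 - nu_p / p] means counting the [n] modulo [m] that avoid all
   classes [h_i] mod [p]; exchanging the two sums turns the average over the
   tuples into a k-th power moment of sifted intervals of length [h]. *)
Lemma mean_fac (R : realFieldType) (k h : nat) (U : seq nat) :
  uniq U -> all prime U -> (0 < k)%N ->
  (2 * k * \prod_(p <- U) p <= h)%N ->
  `|\sum_(f : {ffun 'I_k -> 'I_h}) \prod_(p <- U) fac R f p - h%:R ^+ k|
  <= h%:R ^+ k * (2 * k%:R * (\prod_(p <- U) p)%:R / h%:R).
Proof.
move=> uU pU k0; set m := (\prod_(p <- U) p)%N; set c := (\prod_(p <- U) p.-1)%N.
move=> km.
have m_gt0 : (0 < m)%N.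
  by rewrite /m big_seq; apply: prodn_cond_gt0 => p /(allP pU) /prime_gt0.
have c_gt0 : (0 < c)%N.
  rewrite /c big_seq; apply: prodn_cond_gt0 => p /(allP pU) /prime_gt1.
  by case: p => // [[]].
have mh : (m <= h)%N by nia.
have h_gt0 : (0 < h)%N by lia.
have mR : 0 < m%:R :> R by rewrite ltr0n.
have cR : 0 < c%:R :> R by rewrite ltr0n.
pose N (n : nat) := (\sum_(j < h) all (fun p => j.+1 %% p != n %% p) U)%N.
have -> : \sum_(f : {ffun 'I_k -> 'I_h}) \prod_(p <- U) fac R f p =
          m%:R^-1 * \sum_(n < m) ((N n)%:R * (m%:R / c%:R)) ^+ k.
  rewrite (eq_bigr _ (fun f _ => prod_fac R f pU)) -!mulr_suml -natr_sum.
  rewrite sum_prod_occ // -/m -/c natr_sum -mulrA mulr_suml.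
  rewrite mulr_sumr; apply: eq_bigr => n _.
  by rewrite natrX [in RHS]exprMn mulrCA.
have E : h%:R ^+ k = m%:R^-1 * \sum_(n < m) h%:R ^+ k :> R.
  by rewrite sumr_const card_ord -[X in _ * X]mulr_natr mulrCA mulVf ?mulr1 // gt_eqF.
rewrite [in X in `|X|]E -mulrBr -sumrB normrM ger0_norm ?invr_ge0 ?ler0n //.
rewrite ler_pdivrMl //.
apply: (le_trans (ler_norm_sum _ _ _)).
rewrite (_ : m%:R * (h%:R ^+ k * (2 * k%:R * m%:R / h%:R)) =
  \sum_(n < m) h%:R ^+ k * (2 * k%:R * m%:R / h%:R)); last first.
  by rewrite sumr_const card_ord mulr_natl.
apply: ler_sum => n _.
have := sum_sieved n h uU pU; rewrite -/m -/c -/(N n) => /= /andP[lo hi].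
apply: exprn_perturb; rewrite ?ltr0n ?ler0n ?ler_nat //; last first.
  by rewrite -!natrM ler_nat.
(* With [q = h %/ m], the count lies between [q c] and [(q + 1) c]. Rescaled by [m / c] it lies
   between [q m] and [(q + 1) m], hence within [m] of [h]. *)
have hm := divn_eq h m; have rm := ltn_pmod h m_gt0.
rewrite [_ * (_ / _)]mulrA ler_pdivlMr // ler_pdivrMr //.
rewrite -natrB // -natrD -!natrM !ler_nat.
move: lo hi hm rm; set q := (h %/ m)%N => lo hi hm rm; apply/andP; split.
  apply: (@leq_trans (q * c * m)); last by rewrite leq_mul2r lo orbT.
  by rewrite mulnAC leq_mul2r; apply/orP; right; lia.
apply: (@leq_trans (q.+1 * c * m)); first by rewrite leq_mul2r hi orbT.
by rewrite mulnAC leq_mul2r; apply/orP; right; lia.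
Qed.

Lemma fac_ge0 (R : realFieldType) (k h : nat) (f : {ffun 'I_k -> 'I_h}) (p : nat) :
  prime p -> 0 <= fac R f p.
Proof.
move=> pp; have p0 : 0 < p%:R :> R by rewrite ltr0n prime_gt0.
rewrite divr_ge0 ?exprn_ge0 // subr_ge0 ?ler_pdivrMr // ?mul1r ?ler_nat ?occ_le //.
by rewrite invf_le1 // ler1n prime_gt0.
Qed.

Lemma fac_le1 (R : realFieldType) (k h : nat) (f : {ffun 'I_k -> 'I_h}) (p : nat) :
  injective f -> (h < p)%N -> prime p -> fac R f p <= 1.
Proof.
move=> fI hp pp; have p1 : 1 < p%:R :> R by rewrite ltr1n prime_gt1.
have p0 : 0 < p%:R :> R by lra.
have q1 : p%:R^-1 < 1 :> R by rewrite invf_lt1.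
rewrite /fac occ_distinct // ler_pdivrMr ?exprn_gt0 ?subr_gt0 // mul1r.
by apply: bernoulli; rewrite invr_ge0 !ltW.
Qed.

(** * The singular series as a limit *)

Lemma card_tuple_fset (k h : nat) (f : {ffun 'I_k -> 'I_h}) :
  injectiveb f -> #|` [fset (f i).+1%:Z | i in 'I_k]%fset| = k.
Proof.
move=> /injectiveP fI; rewrite card_imfset /=; last by move=> i j [] /val_inj /fI.
by rewrite -cardE card_ord.
Qed.

Lemma nu_occ (k h : nat) (f : {ffun 'I_k -> 'I_h}) (p : nat) :
  (0 < p)%N -> nu [fset (f i).+1%:Z | i in 'I_k]%fset p = occ f p.
Proof.
move=> p0; rewrite /nu /occ.
set S := [set r : 'I_p | _]%SET.
transitivity #|` [fset (val r)%:Z | r in S]%fset|; last first.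
  by rewrite card_imfset /= -?cardE // => i j [] /val_inj.
congr (#|` _|); apply/fsetP => x; apply/imfsetP/imfsetP => /=.
  case=> y /imfsetP[/= i _ ->] ->.
  exists (Ordinal (ltn_pmod (f i).+1 p0)); last by rewrite modz_nat.
  by rewrite inE; apply/existsP; exists i.
case=> r; rewrite inE => /existsP[i /eqP ri] ->.
exists (f i).+1%:Z; last by rewrite modz_nat ri.
by apply/imfsetP; exists i.
Qed.

Lemma singular_factor_fac (R : realType) (k h : nat) (f : {ffun 'I_k -> 'I_h})
  (p : nat) : injectiveb f -> prime p ->
  singular_factor R [fset (f i).+1%:Z | i in 'I_k]%fset p = fac R f p.
Proof.
by move=> fI pp; rewrite /singular_factor /fac nu_occ ?prime_gt0 // card_tuple_fset.
Qed.

Lemma cvg_prod_fac (R : realType) (k h : nat) (f : {ffun 'I_k -> 'I_h}) :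
  injective f -> cvgn (fun N : nat => \prod_(0 <= p < N | prime p) fac R f p).
Proof.
move=> fI; set u := fun N : nat => _.
(* From [N = h + 1] on, each new factor belongs to a prime above [h] and lies between 0 and 1, so
   the partial products converge monotonically. *)
have ui : nonincreasing_seq [sequence u (n + h.+1)%N]_n.
  apply/nonincreasing_seqP => n; rewrite /= /u addSn big_mkcond /=.
  rewrite big_nat_recr //= -big_mkcond /=; case: ifPn => [pp|_]; last by rewrite mulr1.
  rewrite ler_piMr //; last by apply: fac_le1 => //; lia.
  by apply: prodr_ge0 => p; exact: fac_ge0.
have := nonincreasing_is_cvgn ui; case/(_ _)/cvg_ex => [|l].
  by exists 0 => _ [n _ <-]; apply: prodr_ge0 => p; exact: fac_ge0.
by rewrite cvg_shiftn => ul; apply/cvg_ex; exists l.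
Qed.

(** The finite sum over tuples commutes with the limit, and closed bounds pass to it. What remains
    is to estimate finite products uniformly in [N]. *)
Lemma T_dist_le (R : realType) (k h N0 : nat) (B : R) :
  (forall N : nat, (N0 <= N)%N ->
    `|\sum_(f : {ffun 'I_k -> 'I_h} | injectiveb f)
        \prod_(0 <= p < N | prime p) fac R f p - h%:R ^+ k| <= B) ->
  `|T R k h - h%:R ^+ k| <= B.
Proof.
move=> H.
have cT : ((fun N : nat => \sum_(f : {ffun 'I_k -> 'I_h} | injectiveb f)
    \prod_(0 <= p < N | prime p) fac R f p) @ \oo --> T R k h)%classic.
  rewrite /T; apply: cvg_big => [|f fI]; first exact: add_continuous.
  rewrite /singular_series (_ : (fun N : nat => _) =
    fun N : nat => \prod_(0 <= p < N | prime p) fac R f p); last first.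
    by apply/funext => N; apply: eq_bigr => p pp; rewrite singular_factor_fac.
  by apply: cvg_prod_fac; apply/injectiveP.
rewrite ler_distl; apply/andP; split.
  by apply: (cvgr_to_ge cT); exists N0 => // N /= /H; rewrite ler_distl => /andP[].
by apply: (cvgr_to_le cT); exists N0 => // N /= /H; rewrite ler_distl => /andP[].
Qed.

(** * Subset expansions and sums over pairs *)

Lemma prod_add_subset (R : comPzRingType) (I : finType) (X : {set I}) (F G : I -> R) :
  \prod_(p in X) (F p + G p) =
  \sum_(J : {set I} | J \subset X) (\prod_(p in J) F p * \prod_(p in X :\: J) G p).
Proof.
(* Outside [X] the values 0 and 1 kill every subset not contained in [X] and leave the others
   unchanged. *)
pose F' p := if p \in X then F p else 0.
pose G' p := if p \in X then G p else 1.
rewrite big_mkcond /= (eq_bigr (fun p => F' p + G' p)); last first.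
  by move=> p _; rewrite /F' /G'; case: ifP => // _; rewrite add0r.
rewrite bigA_distr [RHS]big_mkcond /=; apply: eq_bigr => J _.
rewrite (bigID (mem J)) /=.
rewrite (eq_bigr (fun p => F' p)); last by move=> p ->.
rewrite (eq_bigr (fun p => G' p) (P := fun p => p \notin J)); last first.
  by move=> p /negbTE ->.
case: ifPn => [JX|/subsetPn[p pJ pX]]; last first.
  by rewrite (bigD1 p) //= /F' (negbTE pX) !mul0r.
congr (_ * _).
  by apply: eq_bigr => p pJ; rewrite /F' (subsetP JX).
rewrite /G' -big_mkcondr; apply: eq_bigl => p; by rewrite inE.
Qed.

Lemma prod_1add_subset (R : comPzRingType) (I : finType) (X : {set I}) (F : I -> R) :
  \prod_(p in X) (1 + F p) = \sum_(J : {set I} | J \subset X) \prod_(p in J) F p.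
Proof.
under eq_bigr do rewrite addrC.
by rewrite prod_add_subset; apply: eq_bigr => J _; rewrite [X in _ * X]big1 ?mulr1.
Qed.

(** The signs add up to [(1 - 1) ^ #|S|], so the common value [H] survives only for empty [S]; each
    of the [2 ^ #|S|] subsets costs at most [e]. *)
Lemma sum_alternating_le (R : realFieldType) (I : finType) (S : {set I})
  (V : {set I} -> R) (H e : R) :
  (forall J : {set I}, J \subset S -> `|V J - H| <= e) ->
  `|\sum_(J : {set I} | J \subset S) V J * (\prod_(p in S :\: J) -1)
    - H * (S == set0)%:R| <= 2 ^+ #|S| * e.
Proof.
move=> VH.
have -> : (S == set0)%:R = \sum_(J : {set I} | J \subset S) \prod_(p in S :\: J) -1 :> R.
  transitivity (\prod_(p in S) (1 + -1) : R).
    case: eqVneq => [->|/set0Pn[p pS]]; first by rewrite big_set0.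
    by rewrite (bigD1 p) //= subrr mul0r.
  rewrite prod_add_subset; apply: eq_bigr => J _.
  by rewrite big1 ?mul1r.
rewrite mulr_sumr -sumrB; apply: (le_trans (ler_norm_sum _ _ _)).
rewrite -natrX -card_powerset mulr_natl -sumr_const.
rewrite [leRHS](eq_bigl (fun J : {set I} => J \subset S)); last by move=> J; rewrite inE.
apply: ler_sum => J JS; rewrite -mulrBl normrM normr_prod.
by rewrite [X in _ * X]big1 ?mulr1 ?VH // => p _; rewrite normrN1.
Qed.

(** The product is at most the k-th power of its largest factor, which is one of the summands. *)
Lemma prod_le_sum_exp (R : realFieldType) (k : nat) (B : 'I_k -> R) :
  (0 < k)%N -> (forall j, 0 <= B j) -> \prod_j B j <= \sum_j B j ^+ k.
Proof.
case: k B => // k B _ B0.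
case: (@Order.TotalTheory.arg_maxP _ _ _ ord0 xpredT B) => // j _ jmax.
apply: (@le_trans _ _ (B j ^+ k.+1)); last first.
  by rewrite (bigD1 j) //= lerDl sumr_ge0 // => i _; rewrite exprn_ge0.
rewrite (_ : B j ^+ k.+1 = \prod_(i < k.+1) B j); last by rewrite prodr_const card_ord.
by apply: ler_prod => i _; rewrite B0 /=; exact: jmax.
Qed.

(* Bounding a product of [k] factors by the sum of their [k]-th powers reduces
   the product over all pairs to stars centred at one index [j], over which the
   sum factorizes. *)
Lemma sum_pairs_le (R : realFieldType) (k h : nat) (g : 'I_h -> 'I_h -> R) (G : R) :
  (0 < k)%N -> (forall x y, 0 <= g x y) ->
  (forall y, \sum_x g x y ^+ k <= G) ->
  \sum_(f : {ffun 'I_k -> 'I_h}) \prod_(j : 'I_k) \prod_(i | i != j) g (f i) (f j)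
  <= k%:R * h%:R * G ^+ k.-1.
Proof.
move=> k0 g0 gG.
apply: (@le_trans _ _ (\sum_(f : {ffun 'I_k -> 'I_h})
    \sum_(j : 'I_k) \prod_(i | i != j) g (f i) (f j) ^+ k)).
  apply: ler_sum => f _.
  apply: (le_trans (prod_le_sum_exp k0 _)).
    by move=> j; apply: prodr_ge0.
  by apply: ler_sum => j _; rewrite prodrXl.
rewrite exchange_big /= -mulrA mulr_natl -[X in _ *+ X]card_ord -sumr_const.
apply: ler_sum => j _.
rewrite (partition_big (fun f : {ffun 'I_k -> 'I_h} => f j) xpredT) //=.
rewrite mulr_natl -[X in _ *+ X](card_ord h) -sumr_const.
apply: ler_sum => v _.
(* The constraint [f j = v] becomes an indicator factor at index [j], so the sum over tuples is a
   product of [k] independent sums. *)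
pose F (i : 'I_k) (x : 'I_h) : R := if i == j then (x == v)%:R else g x v ^+ k.
rewrite [leLHS](_ : _ = \sum_(f : {ffun 'I_k -> 'I_h}) \prod_i F i (f i)); last first.
  rewrite [LHS]big_mkcond /=; apply: eq_bigr => f _.
  rewrite [RHS](bigD1 j) //= {1}/F eqxx; case: (eqVneq (f j) v) => [->|_]; last by rewrite mul0r.
  by rewrite mul1r; apply: eq_bigr => i /negbTE ij; rewrite /F ij.
rewrite -(bigA_distr_bigA F) /= (bigD1 j) //=.
rewrite [X in X * _](_ : _ = 1) ?mul1r; last first.
  rewrite (bigD1 v) //= /F eqxx eqxx big1 ?addr0 // => x xv.
  by rewrite (negbTE xv).
apply: (@le_trans _ _ (\prod_(i : 'I_k | i != j) G)).
  apply: ler_prod => i /negbTE ij; rewrite /F ij gG andbT.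
  by apply: sumr_ge0 => x _; apply: exprn_ge0.
rewrite prodr_const (_ : #|_| = k.-1) //.
by rewrite -[in RHS](card_ord k) -(cardC1 j); apply: eq_card.
Qed.

Lemma card_noninjective (k h : nat) :
  (#|[set f : {ffun 'I_k -> 'I_h} | ~~ injectiveb f]| <= k ^ 2 * h ^ k.-1)%N.
Proof.
have -> : #|[set f : {ffun 'I_k -> 'I_h} | ~~ injectiveb f]| = (h ^ k - h ^_ k)%N.
  have := cardsC [set f : {ffun 'I_k -> 'I_h} | injectiveb f].
  rewrite card_ffun !card_ord => <-.
  rewrite (_ : h ^_ k = #|[set f : {ffun 'I_k -> 'I_h} | injectiveb f]|); last first.
    by have := card_inj_ffuns 'I_k 'I_h; rewrite !card_ord.
  by rewrite addKn; apply: eq_card => f; rewrite !inE.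
(* Passing from [k] to [k + 1] multiplies the power by [h] and the falling factorial by [h - k]: the
   difference is multiplied by [h] and grows by at most a further [k h ^ k]. *)
elim: k => [|k IH] //.
have le : (h ^_ k <= h ^ k)%N.
  by elim: (k) => [|m IHm]; rewrite ?ffactn0 // ffactnSr expnSr leq_mul ?leq_subr.
move: le.
move: IH; rewrite ffactnSr expnS /=.
case: k => [|k]; first by rewrite ffactn0 !expn0; lia.
rewrite -pred_Sn expnS expn1 [in X in _ -> _ -> X]expnS.
set b := (h ^ k.+1)%N; have -> : (b = h * h ^ k)%N by rewrite /b expnS.
set c := (h ^ k)%N; set a := (h ^_ k.+1)%N => IH le.
have IHh : ((h * c - a) * h <= k.+1 * k.+1 * c * h)%N by rewrite leq_mul2r IH orbT.
(* In the first case the truncated factor [h - k.+1] is 0. *)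
have [hk|kh] := leqP h k.+1.
  have : (h * (h * c) <= k.+1 * (h * c))%N by rewrite leq_mul2r hk orbT.
  by nia.
have ak : (a * k.+1 <= h * c * k.+1)%N by rewrite leq_mul2r le orbT.
rewrite mulnBl in IHh; rewrite mulnBr.
have : (a * k.+1 <= a * h)%N by rewrite leq_mul2l ltnW ?orbT.
by nia.
Qed.

(** * Bounds for single factors *)

(* [(n / m) ^ (1 - s) >= 1 + (1 - s) ln (n / m)] and [ln (n / m) >= 1 - m / n]. *)
Lemma powR_telescope (R : realType) (s : R) (n : nat) : s <= 1 / 2 -> (0 < n)%N ->
  n.+1%:R `^ (s - 2) <= 2 * (n%:R `^ (s - 1) - n.+1%:R `^ (s - 1)).
Proof.
move=> s2 n0; set a : R := n%:R; set b : R := n.+1%:R.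
have a0 : 0 < a by rewrite ltr0n.
have b0 : 0 < b by rewrite ltr0n.
have ba : b = a + 1 by rewrite /b /a -natr1.
have -> : b `^ (s - 2) = b `^ (s - 1) / b.
  rewrite -powR_inv1 ?ltW // -powRD; first by congr powR; lra.
  by rewrite (gt_eqF b0) implybT.
have -> : a `^ (s - 1) = b `^ (s - 1) * expR ((1 - s) * - ln (a / b)).
  rewrite /powR !gt_eqF // -expRD lnM ?posrE ?invr_gt0 // lnV ?posrE //.
  by congr expR; ring.
have bp : 0 < b `^ (s - 1) by apply: powR_gt0.
have L : b^-1 <= - ln (a / b).
  have ab : 0 < a / b by apply: divr_gt0.
  have := expR_ge1Dx (ln (a / b)); rewrite lnK ?posrE //.
  have -> : a / b = 1 - b^-1.
    have -> : a = b - 1 by rewrite ba addrK.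
    by rewrite mulrBl mul1r divff // gt_eqF.
  by set l := ln _; rewrite addrC -lerBrDr addrAC subrr add0r lerNr.
have E := expR_ge1Dx ((1 - s) * - ln (a / b)).
have : (1 - s) * b^-1 <= (1 - s) * - ln (a / b) by rewrite ler_wpM2l //; lra.
have : 1 / 2 * b^-1 <= (1 - s) * b^-1 by rewrite ler_wpM2r ?invr_ge0 ?(ltW b0) //; lra.
move=> h1 h2.
have -> : 2 * (b `^ (s - 1) * expR ((1 - s) * - ln (a / b)) - b `^ (s - 1)) =
  b `^ (s - 1) * (2 * (expR ((1 - s) * - ln (a / b)) - 1)) by ring.
rewrite ler_pM2l //; move: E h1 h2.
move: b^-1 ((1 - s) * b^-1) ((1 - s) * - ln (a / b)) (expR _) => w v u e; lra.
Qed.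

Lemma powR_tail (R : realType) (s : R) (z N : nat) : s <= 1 / 2 -> (0 < z)%N ->
  \sum_(z.+1 <= n < N) n%:R `^ (s - 2) <= 2 * (z%:R `^ (s - 1) : R).
Proof.
move=> s2 z0.
have [Nz|zN] := leqP N z.+1; first by rewrite big_geq // mulr_ge0 ?powR_ge0.
have {zN} -> : N = (z.+1 + (N - z.+1))%N by lia.
set d := (N - z.+1)%N.
(* The telescoped end term is kept to make the induction go through. *)
suff : \sum_(z.+1 <= n < z.+1 + d) n%:R `^ (s - 2) <=
       2 * (z%:R `^ (s - 1) - (z + d)%:R `^ (s - 1)) :> R.
  by have := powR_ge0 ((z + d)%:R : R) (s - 1); lra.
elim: (d) => [|m IH]; first by rewrite !addn0 big_geq // subrr mulr0.
rewrite addnS big_nat_recr ?leq_addr //= addSn addnS.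
have := powR_telescope s2 (ltn_addr m z0).
by move: IH; rewrite addSn; lra.
Qed.

Lemma prod_1add_powR (R : realType) (s c : R) (z N : nat) (X : {set 'I_N}) :
  s <= 1 / 2 -> (0 < z)%N -> 0 <= c -> (forall p : 'I_N, p \in X -> (z < p)%N) ->
  \prod_(p in X) (1 + c * (p%:R `^ (s - 2))) <= expR (2 * c * (z%:R `^ (s - 1))).
Proof.
move=> s2 z0 c0 Xz.
have pw0 (p : nat) : 0 <= p%:R `^ (s - 2) :> R by apply: powR_ge0.
apply: (@le_trans _ _ (\prod_(p in X) expR (c * (p%:R `^ (s - 2))))).
  by apply: ler_prod => p _; rewrite expR_ge1Dx addr_ge0 // mulr_ge0.
rewrite -expR_sum ler_expR -mulr_sumr [2 * c]mulrC -mulrA ler_wpM2l //.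
apply: le_trans (powR_tail N s2 z0).
rewrite (big_nat_widenl _ 0) // big_mkord big_mkcond [leRHS]big_mkcond /=.
apply: ler_sum => p _; case: ifPn => [/Xz -> //|_].
by case: ifP.
Qed.

(** Put [y = 1 / p], [a = k y], and let [d] be [y] times the number of collisions. The factor is
    [(1 - a + d) / (1 - y) ^ k], and [1 - a <= (1 - y) ^ k <= 1 / (1 + a)]. Without collisions it is
    within [a ^ 2] of 1; since [(1 - y) ^ k >= 1 / 2], collisions add at most [2 d]. *)
Lemma abs_fac_sub1_le (R : realFieldType) (k h : nat) (f : {ffun 'I_k -> 'I_h})
  (p : nat) : prime p -> (2 * k <= p)%N ->
  `|fac R f p - 1| <= 2 * (k - occ f p)%:R / p%:R + k%:R ^+ 2 / p%:R ^+ 2.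
Proof.
move=> pp kp; have p0 : 0 < p%:R :> R by rewrite ltr0n prime_gt0.
have ok := occ_le_card f (prime_gt0 pp).
set y : R := p%:R^-1; have y0 : 0 < y by rewrite invr_gt0.
have y1 : y < 1 by rewrite invf_lt1 // ltr1n prime_gt1.
have ky : k%:R * y <= 1 / 2.
  by rewrite ler_pdivrMr //; move: kp; rewrite -(ler_nat R) natrM; lra.
have ky0 : 0 <= k%:R * y by rewrite mulr_ge0 // (ltW y0).
have dy0 : 0 <= (k - occ f p)%:R * y by rewrite mulr_ge0 // (ltW y0).
have Y0 : 0 < (1 - y) ^+ k by rewrite exprn_gt0 // subr_gt0.
have B1 : 1 - k%:R * y <= (1 - y) ^+ k by apply: bernoulli; rewrite (ltW y0) (ltW y1).
have B2 : (1 - y) ^+ k * (1 + k%:R * y) <= 1.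
  apply: (@le_trans _ _ ((1 - y) ^+ k * (1 + y) ^+ k)).
    by rewrite ler_wpM2l ?(ltW Y0) // bernoulli_add // ltW.
  rewrite -exprMn exprn_ile1 //; first by rewrite mulr_ge0 //; lra.
  by have := mulr_gt0 y0 y0; lra.
have E : fac R f p = (1 - k%:R * y + (k - occ f p)%:R * y) / (1 - y) ^+ k.
  by rewrite /fac natrB // -/y; congr (_ / _); ring.
have -> : 2 * (k - occ f p)%:R / p%:R + k%:R ^+ 2 / p%:R ^+ 2 =
   2 * ((k - occ f p)%:R * y) + (k%:R * y) ^+ 2 :> R.
  by rewrite /y; field; lra.
rewrite E ler_distl; set a := k%:R * y in B1 B2 ky ky0 *.
set d := _ * y in dy0 *; set Y := (1 - y) ^+ k in Y0 B1 B2 *.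
apply/andP; split.
  rewrite ler_pdivlMr //.
  have : (1 - a ^+ 2) * Y <= 1 - a.
    have a1 : 0 <= 1 - a by lra.
    have := ler_wpM2l a1 B2; rewrite mulr1; apply: le_trans.
    by rewrite le_eqVlt; apply/orP; left; apply/eqP; ring.
  have : 0 <= 2 * d * Y by apply: mulr_ge0 (ltW Y0); apply: mulr_ge0.
  by lra.
rewrite ler_pdivrMr //.
have : d <= 2 * d * Y.
  have : 1 <= 2 * Y by lra.
  by move=> H; have := ler_wpM2l dy0 H; lra.
have : 0 <= a ^+ 2 * Y by apply: mulr_ge0 (sqr_ge0 _) (ltW Y0).
by lra.
Qed.

(** This crude bound suffices because [z ln z] will be at most a small multiple of [ln h]. *)
Lemma prod_primes_le (z : nat) : (\prod_(0 <= p < z.+1 | prime p) p <= z ^ z)%N.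
Proof.
suff H m : (m <= z)%N -> (\prod_(0 <= p < m.+1 | prime p) p <= z ^ m)%N by exact: H.
elim: m => [|m IH] mz; first by rewrite big_mkcond big_nat1.
rewrite big_mkcond big_nat_recr //= -big_mkcond /= expnSr.
apply: leq_mul; first by apply: IH; lia.
by case: ifP => _; lia.
Qed.

(** Each factor is at most [(p / (p - 1)) ^ k], and the product of [n / (n - 1)] over all integers
    from 2 to [z] telescopes to [z]. *)
Lemma prod_fac_le (R : realFieldType) (k h : nat) (f : {ffun 'I_k -> 'I_h}) (z : nat) :
  (0 < z)%N -> \prod_(0 <= p < z.+1 | prime p) fac R f p <= z%:R ^+ k.
Proof.
elim: z => // [[|z] IH] _; first by rewrite big_mkcond !big_nat_recr //= big_geq // !mul1r expr1n.
rewrite big_mkcond big_nat_recr //= -big_mkcond /=.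
have z0 : 0 < z.+1%:R :> R by rewrite ltr0n.
case: ifPn => [pz|_]; last first.
  by rewrite mulr1 (le_trans (IH _)) // lerXn2r ?nnegrE // ler_nat.
apply: (@le_trans _ _ (z.+1%:R ^+ k * (z.+2%:R / z.+1%:R) ^+ k)); last first.
  by rewrite -exprMn mulrCA divff ?mulr1 // gt_eqF.
apply: ler_pM; rewrite ?fac_ge0 ?IH //; first by apply: prodr_ge0 => p; apply: fac_ge0.
rewrite /fac -[_ / z.+1%:R]invf_div -exprVn.
have -> : 1 - z.+2%:R^-1 = z.+1%:R / z.+2%:R :> R.
  have z2 : z.+2%:R != 0 :> R by rewrite pnatr_eq0.
  by rewrite -[X in X - _](divff z2) -[X in _ - X]mul1r -mulrBl -natr1 addrK.
by rewrite ler_piMl ?invr_ge0 ?exprn_ge0 ?divr_ge0.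
Qed.

(** * Collisions modulo large primes *)

(** On the diagonal every [p] would divide the difference; the value 1 there avoids a huge term in
    sums over [x], and injective tuples never meet the diagonal. *)
Definition congr_prod (R : realType) (h N : nat) (X : {set 'I_N}) (c : 'I_N -> R)
  (x y : 'I_h) : R :=
  if x == y then 1 else \prod_(p in X | (x == y %[mod p])%N) (1 + c p).

(** Expanding the product gives a sum over sets [S] of primes that all divide [x - y]. By
    [count_congruent] at most [h] over the product of [S] values of [x] other than [y] qualify, and
    the sum over [S] folds back into a product. *)
Lemma sum_congr_prod (R : realType) (h N : nat) (X : {set 'I_N}) (c : 'I_N -> R)
  (y : 'I_h) : (forall p, p \in X -> prime p) -> (forall p, 0 <= c p) ->
  \sum_x congr_prod X c x y <= 1 + h%:R * \prod_(p in X) (1 + c p / p%:R).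
Proof.
move=> Xp c0; rewrite (bigD1 y) //= {1}/congr_prod eqxx lerD2l.
pose t (S : {set 'I_N}) (x : 'I_h) : R :=
  [forall (p : 'I_N | p \in S), (x == y %[mod p])%N]%:R.
rewrite (eq_bigr (fun x => \sum_(S : {set 'I_N} | S \subset X)
    (\prod_(p in S) c p) * t S x)); last first.
  move=> x xy; rewrite /congr_prod (negbTE xy) big_mkcondr /=.
  rewrite (eq_bigr (fun p : 'I_N => 1 + if (x == y %[mod p])%N then c p else 0)); last first.
    by move=> p _; case: ifP; rewrite ?addr0.
  rewrite prod_1add_subset; apply: eq_bigr => S _; rewrite /t.
  case: forallP => [H|/forallP].
    by rewrite mulr1; apply: eq_bigr => p pS; have := H p; rewrite pS /= => ->.
  rewrite negb_forall => /existsP[p]; rewrite negb_imply => /andP[pS /negbTE npxy].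
  by rewrite (bigD1 p) //= npxy mul0r mulr0.
rewrite exchange_big /= prod_1add_subset mulr_sumr; apply: ler_sum => S SX.
have c0S : 0 <= \prod_(p in S) c p by apply: prodr_ge0.
rewrite -mulr_sumr prodf_div mulrCA ler_wpM2l //.
have Sp : all prime [seq val p | p <- enum S].
  by apply/allP => _ /mapP[p pS ->]; apply: Xp; rewrite (subsetP SX) // -mem_enum.
have Su : uniq [seq val p | p <- enum S] by rewrite map_inj_uniq ?enum_uniq //; apply: val_inj.
set m := (\prod_(p <- [seq val p | p <- enum S]) p)%N.
have -> : \prod_(p in S) p%:R = m%:R :> R by rewrite /m big_map big_enum natr_prod.
have m0 : (0 < m)%N.
  by rewrite /m big_seq; apply: prodn_cond_gt0 => p /(allP Sp) /prime_gt0.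
rewrite ler_pdivlMr ?ltr0n //.
apply: (@le_trans _ _ ((h %/ m * m)%N%:R)); last by rewrite ler_nat leq_trunc_div.
rewrite natrM ler_wpM2r //; apply: le_trans (_ : _ <= _%:R) _; last first.
  by rewrite ler_nat; exact: (count_congruent y m0).
rewrite -sum1_card natr_sum big_mkcond [leRHS]big_mkcond /=.
apply: ler_sum => x _; rewrite inE /t; case: ifP => //= xy.
case: forallP => [H|_]; last by case: ifP.
rewrite eq_mod_prod_primes //; apply/allP => _ /mapP[p pS ->].
by have := H p; rewrite -mem_enum pS.
Qed.

(** By [occ_collisions] the exponent is at most the number of colliding [j], and each of these sees
    the factor [1 + c p] for at least one [i]. *)
Lemma prod_collisions_le (R : realType) (k h N : nat) (f : {ffun 'I_k -> 'I_h})
  (X : {set 'I_N}) (c : 'I_N -> R) : injective f ->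
  (forall p, p \in X -> prime p) -> (forall p, 0 <= c p) ->
  \prod_(p in X) (1 + c p) ^+ (k - occ f p) <=
  \prod_(j : 'I_k) \prod_(i | i != j) congr_prod X c (f i) (f j).
Proof.
move=> fI Xp c0.
have c1 p : 1 <= 1 + c p by rewrite lerDl.
have c1' p : 0 <= 1 + c p by apply: le_trans (c1 p).
pose b (p : 'I_N) (i j : 'I_k) : R := if (f i == f j %[mod p])%N then 1 + c p else 1.
have b1 p i j : 1 <= b p i j by rewrite /b; case: ifP.
apply: (@le_trans _ _ (\prod_(p in X) \prod_(j : 'I_k) \prod_(i | i != j) b p i j)).
  apply: ler_prod => p pX; rewrite exprn_ge0 //=.
  apply: (le_trans (ler_weXn2l (c1 p) (occ_collisions f (prime_gt0 (Xp p pX))))).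
  rewrite -prodr_const big_mkcond /=; apply: ler_prod => j _; rewrite inE.
  have pr1 : 1 <= \prod_(i | i != j) b p i j.
    by apply: (big_ind (fun x : R => 1 <= x)) => // x y; exact: mulr_ege1.
  case: existsP => [[i /andP[ij fij]]|_]; last by rewrite ler01.
  rewrite c1' /= (bigD1 i) //= {1}/b fij ler_peMr //.
  by apply: (big_ind (fun x : R => 1 <= x)) => // x y; exact: mulr_ege1.
rewrite exchange_big /= le_eqVlt; apply/orP; left; apply/eqP; apply: eq_bigr => j _.
rewrite exchange_big /=; apply: eq_bigr => i ij.
rewrite /congr_prod (inj_eq fI) (negbTE ij) big_mkcondr /=.
by apply: eq_bigr.
Qed.

Lemma congr_prod_ge0 (R : realType) (h N : nat) (X : {set 'I_N}) (c : 'I_N -> R)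
  (x y : 'I_h) : (forall p, 0 <= c p) -> 0 <= congr_prod X c x y.
Proof.
move=> c0; rewrite /congr_prod; case: ifP => // _.
by apply: prodr_ge0 => p _; rewrite addr_ge0.
Qed.

Lemma powR_le_base (R : realType) (s : R) (z p : nat) : s <= 1 -> (0 < z)%N ->
  (z <= p)%N -> p%:R `^ (s - 1) <= z%:R `^ (s - 1) :> R.
Proof.
move=> s1 z0 zp; rewrite -opprB !powRN lef_pV2 ?posrE ?powR_gt0 ?ltr0n //; last by lia.
by rewrite ge0_ler_powR ?nnegrE ?ler_nat // subr_ge0.
Qed.

Definition large_primes (z N : nat) : {set 'I_N} := [set p : 'I_N | prime p && (z < p)%N].

(** The k-th powers required by [sum_pairs_le] are harmless: the hypothesis on [k] gives
    [(1 + c) ^ k <= 1 + 2 k c], again of the form treated by [sum_congr_prod]. Dividing by [p] then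
    turns the exponent [s - 1] into the summable [s - 2]. *)
Lemma sum_prod_collisions_le (R : realType) (k h z N : nat) (s : R) :
  (0 < k)%N -> (0 < z)%N -> s <= 1 / 2 -> 4 * k%:R * (z%:R `^ (s - 1)) <= 1 ->
  \sum_(f : {ffun 'I_k -> 'I_h} | injectiveb f)
    \prod_(p in large_primes z N) (1 + 2 * (p%:R `^ (s - 1))) ^+ (k - occ f p)
  <= k%:R * h%:R * (1 + h%:R * expR (8 * k%:R * (z%:R `^ (s - 1)))) ^+ k.-1.
Proof.
move=> k0 z0 s2 kz; set X := large_primes z N.
have Xp (p : 'I_N) : p \in X -> prime p by rewrite inE => /andP[].
have Xz (p : 'I_N) : p \in X -> (z < p)%N by rewrite inE => /andP[].
pose c (p : 'I_N) : R := 2 * (p%:R `^ (s - 1)).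
have c0 p : 0 <= c p by rewrite mulr_ge0 ?powR_ge0.
apply: (@le_trans _ _ (\sum_(f : {ffun 'I_k -> 'I_h})
    \prod_(j : 'I_k) \prod_(i | i != j) congr_prod X c (f i) (f j))).
  rewrite big_mkcond; apply: ler_sum => f _; case: ifPn => [/injectiveP fI|_].
    exact: prod_collisions_le.
  by do 2!(apply: prodr_ge0 => ? _); apply: congr_prod_ge0.
apply: sum_pairs_le => // [x y|y]; first exact: congr_prod_ge0.
pose c' (p : 'I_N) : R := 2 * k%:R * c p.
have c'0 p : 0 <= c' p by rewrite !mulr_ge0.
apply: (@le_trans _ _ (\sum_x congr_prod X c' x y)).
  apply: ler_sum => x _; rewrite /congr_prod; case: ifP => _; first by rewrite expr1n.
  rewrite -prodrXl; apply: ler_prod => p /andP[/Xz zp _].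
  rewrite exprn_ge0 ?addr_ge0 //= bernoulli_upper //.
  apply: le_trans kz; have : p%:R `^ (s - 1) <= z%:R `^ (s - 1) :> R.
    by apply: powR_le_base; [lra| |exact: ltnW].
  have k0' : 0 <= k%:R :> R by [].
  by move=> H; have := ler_wpM2l k0' H; rewrite /c; lra.
apply: (le_trans (sum_congr_prod y Xp c'0)).
rewrite lerD2l ler_wpM2l //.
rewrite (eq_bigr (fun p : 'I_N => 1 + 4 * k%:R * (p%:R `^ (s - 2)))); last first.
  move=> p /Xp /prime_gt0 p0; congr (1 + _); rewrite /c' /c.
  have -> : p%:R `^ (s - 2) = p%:R `^ (s - 1) / p%:R :> R.
    rewrite -powR_inv1 // -powRD; first by congr powR; lra.
    by rewrite pnatr_eq0 -lt0n p0 implybT.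
  by ring.
apply: (le_trans (prod_1add_powR s2 z0 _ Xz)); first by rewrite mulr_ge0.
by rewrite ler_expR le_eqVlt; apply/orP; left; apply/eqP; ring.
Qed.

(** * Expansion over the primes beyond [z] *)

Definition smooth_fac (R : realType) (k h : nat) (f : {ffun 'I_k -> 'I_h}) (z : nat) : R :=
  \prod_(0 <= p < z.+1 | prime p) fac R f p.

Lemma smooth_fac_ge0 (R : realType) (k h : nat) (f : {ffun 'I_k -> 'I_h}) (z : nat) :
  0 <= smooth_fac R f z.
Proof. by apply: prodr_ge0 => p; apply: fac_ge0. Qed.

Lemma prod_fac_split (R : realType) (k h : nat) (f : {ffun 'I_k -> 'I_h}) (z N : nat) :
  (z < N)%N ->
  \prod_(0 <= p < N | prime p) fac R f p =
  smooth_fac R f z * \prod_(p in large_primes z N) (1 + (fac R f p - 1)).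
Proof.
move=> zN; rewrite (big_cat_nat (n := z.+1)) //=; congr (_ * _).
rewrite (big_nat_widenl _ 0) // big_mkord; apply: eq_big => p; first by rewrite inE.
by rewrite addrC subrK.
Qed.

(** This is [mean_fac] for the primes up to [z] together with those in [J], whose product is at most
    [z ^ z * Q]. *)
Lemma mean_smooth_fac (R : realType) (k h z N : nat) (Q : R) (J : {set 'I_N}) :
  (0 < k)%N -> (0 < h)%N -> J \subset large_primes z N ->
  \prod_(p in J) p%:R <= Q -> 2 * k%:R * z%:R ^+ z * Q <= h%:R ->
  `|\sum_(f : {ffun 'I_k -> 'I_h}) smooth_fac R f z * \prod_(p in J) fac R f p
    - h%:R ^+ k| <= h%:R ^+ k * (2 * k%:R * z%:R ^+ z * Q / h%:R).
Proof.
move=> k0 h0 JX JQ zQ.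
pose U1 := [seq p <- index_iota 0 z.+1 | prime p].
pose U2 := [seq val p | p <- enum J].
have JXp (p : 'I_N) : p \in enum J -> prime p && (z < p)%N.
  by rewrite mem_enum => /(subsetP JX); rewrite inE.
have U1p : all prime U1 by apply/allP => p; rewrite mem_filter => /andP[].
have U2p : all prime U2 by apply/allP => _ /mapP[p /JXp /andP[pp _] ->].
have Uu : uniq (U1 ++ U2).
  rewrite cat_uniq filter_uniq ?iota_uniq // map_inj_uniq ?enum_uniq ?andbT; last exact: val_inj.
  apply/hasPn => _ /mapP[p /JXp /andP[_ zp] ->].
  by rewrite mem_filter mem_index_iota negb_and -leqNgt zp orbT.
have Up : all prime (U1 ++ U2) by rewrite all_cat U1p.
have prodU (F : nat -> R) : \prod_(p <- U1 ++ U2) F p =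
    \prod_(0 <= p < z.+1 | prime p) F p * \prod_(p in J) F p.
  by rewrite big_cat big_filter big_map big_enum.
have mle : (\prod_(p <- U1 ++ U2) p)%:R <= z%:R ^+ z * Q :> R.
  rewrite natr_prod prodU ler_pM ?prodr_ge0 //.
  by rewrite -natr_prod -natrX ler_nat prod_primes_le.
have h0' : 0 < h%:R :> R by rewrite ltr0n.
have := @mean_fac R k h _ Uu Up k0 _.
rewrite (eq_bigr (fun f => smooth_fac R f z * \prod_(p in J) fac R f p)); last first.
  by move=> f _; rewrite prodU.
have km : 2 * k%:R * (\prod_(p <- U1 ++ U2) p)%:R <= 2 * k%:R * z%:R ^+ z * Q.
  by rewrite -[leRHS]mulrA ler_wpM2l // mulr_ge0.
move=> H; apply: le_trans (H _) _.
  by rewrite -(ler_nat R) !natrM (le_trans km).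
by rewrite ler_wpM2l ?exprn_ge0 // ler_wpM2r // invr_ge0.
Qed.

(** Expanding the product of [fac - 1] over subsets [J] of [S] gives averages that are all close to
    [h ^ k], so they cancel by [sum_alternating_le] unless [S] is empty. *)
Lemma mean_large_fac (R : realType) (k h z N : nat) (Q : R) (S : {set 'I_N}) :
  (0 < k)%N -> (0 < h)%N -> S \subset large_primes z N ->
  \prod_(p in S) p%:R <= Q -> 2 * k%:R * z%:R ^+ z * Q <= h%:R ->
  `|\sum_(f : {ffun 'I_k -> 'I_h}) smooth_fac R f z * \prod_(p in S) (fac R f p - 1)
    - h%:R ^+ k * (S == set0)%:R|
  <= 2 ^+ #|S| * (h%:R ^+ k * (2 * k%:R * z%:R ^+ z * Q / h%:R)).
Proof.
move=> k0 h0 SX SQ zQ.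
rewrite (eq_bigr (fun f => \sum_(J : {set 'I_N} | J \subset S)
   (smooth_fac R f z * \prod_(p in J) fac R f p) * (\prod_(p in S :\: J) -1))); last first.
  move=> f _; rewrite prod_add_subset mulr_sumr.
  by apply: eq_bigr => J _; rewrite mulrA.
rewrite exchange_big /=.
under eq_bigr do rewrite -mulr_suml.
apply: sum_alternating_le => J JS; apply: mean_smooth_fac => //.
  exact: subset_trans JS SX.
apply: le_trans SQ; rewrite [leRHS](big_setID J) /= (setIidPr JS).
rewrite ler_peMr ?prodr_ge0 //.
apply: (big_ind (fun x : R => 1 <= x)) => // [x y|p]; first exact: mulr_ege1.
rewrite inE => /andP[_ /(subsetP SX)]; rewrite inE => /andP[/prime_gt0 p0 _].
by rewrite ler1n.
Qed.

(** Since [1 <= (Q / q) ^ 2] for the product [q <= Q] of [S], the sum is at most [Q ^ 2] times the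
    product of [1 + 2 / p ^ 2]. Weakening [p ^ (-2)] to [p ^ (s - 2)] allows [prod_1add_powR] to be
    reused. *)
Lemma sum_small_subsets (R : realType) (z N : nat) (Q s : R) :
  (0 < z)%N -> 0 <= s <= 1 / 2 -> 1 <= Q ->
  \sum_(S : {set 'I_N} | (S \subset large_primes z N) && (\prod_(p in S) p%:R <= Q))
    2 ^+ #|S| <= Q ^+ 2 * expR (4 * (z%:R `^ (s - 1))).
Proof.
move=> z0 /andP[s0 s2] Q1; set X := large_primes z N.
have Xp (p : 'I_N) : p \in X -> (0 < p)%N by rewrite inE => /andP[/prime_gt0].
have Xz (p : 'I_N) : p \in X -> (z < p)%N by rewrite inE => /andP[].
apply: (@le_trans _ _ (\sum_(S : {set 'I_N} | S \subset X)
    Q ^+ 2 * \prod_(p in S) (2 / p%:R ^+ 2))).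
  rewrite big_mkcondr; apply: ler_sum => S SX.
  have P0 : 0 < \prod_(p in S) p%:R :> R.
    by apply: prodr_gt0 => p /(subsetP SX) /Xp; rewrite ltr0n.
  case: ifPn => [SQ|_]; last first.
    by rewrite mulr_ge0 ?exprn_ge0 ?prodr_ge0 // ?(le_trans ler01) // => p _; rewrite divr_ge0 ?exprn_ge0.
  rewrite prodf_div prodr_const prodrXl mulrCA ler_peMr ?exprn_ge0 //.
  rewrite -expr_div_n exprn_ege1 // ler_pdivlMr // mul1r //.
rewrite -mulr_sumr -prod_1add_subset ler_wpM2l ?exprn_ge0 ?(le_trans ler01) //.
have -> : 4 = 2 * 2 :> R by ring.
have le02 : 0 <= 2 :> R by [].
apply: le_trans (prod_1add_powR s2 z0 le02 Xz).
apply: ler_prod => p /Xp p0; rewrite addr_ge0 ?divr_ge0 ?exprn_ge0 //= lerD2l ler_wpM2l //.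
by rewrite -powR_invn // ler_powR ?ler1n //; lra.
Qed.

(** * The truncated sum *)

(** As [1 / p <= p ^ (s - 1) <= z ^ (s - 1)], the hypothesis on [k] even gives [4 k <= p]. *)
Lemma small_tuple_le_prime (R : realType) (k z p : nat) (s : R) :
  (0 < z)%N -> 0 <= s <= 1 -> 4 * k%:R * (z%:R `^ (s - 1)) <= 1 ->
  (z <= p)%N -> (2 * k <= p)%N.
Proof.
move=> z0 /andP[s0 s1] kz zp.
have p0 : 0 < p%:R :> R by rewrite ltr0n; lia.
have p1 : 1 <= p%:R :> R by rewrite ler1n; lia.
have : p%:R^-1 <= z%:R `^ (s - 1) :> R.
  apply: le_trans (powR_le_base s1 z0 zp).
  by rewrite -powR_inv1 ?(ltW p0) // ler_powR //; lra.
move=> H; have k4 : 0 <= 4 * k%:R :> R by rewrite mulr_ge0.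
have {H} := le_trans (ler_wpM2l k4 H) kz.
rewrite ler_pdivrMr // mul1r -natrM ler_nat; lia.
Qed.

Lemma abs_fac_sub1_le2 (R : realFieldType) (k h : nat) (f : {ffun 'I_k -> 'I_h})
  (p : nat) : prime p -> (2 * k <= p)%N -> `|fac R f p - 1| <= 2.
Proof.
move=> pp kp; apply: (le_trans (abs_fac_sub1_le R f pp kp)).
have p0 : 0 < p%:R :> R by rewrite ltr0n prime_gt0.
have kp' : 2 * k%:R <= p%:R :> R by rewrite -natrM ler_nat.
have k0 : 0 <= k%:R :> R by [].
have d : (k - occ f p)%:R <= k%:R :> R by rewrite ler_nat leq_subr.
have : 2 * (k - occ f p)%:R / p%:R <= 1 :> R by rewrite ler_pdivrMr //; lra.
have : k%:R ^+ 2 / p%:R ^+ 2 <= 1 :> R.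
  by rewrite -expr_div_n exprn_ile1 ?divr_ge0 // ler_pdivrMr //; lra.
by lra.
Qed.

(** With [u = k ^ 2 p ^ (s - 2)], [t = 2 p ^ (s - 1)] and [d] collisions,
    [1 + u + d t <= (1 + u) (1 + t) ^ d]. This separates a factor independent of [f] from one that
    depends on collisions only. *)
Lemma rankin_factor_le (R : realType) (k h : nat) (f : {ffun 'I_k -> 'I_h})
  (p : nat) (s : R) : prime p -> (2 * k <= p)%N ->
  1 + p%:R `^ s * `|fac R f p - 1| <=
  (1 + k%:R ^+ 2 * (p%:R `^ (s - 2))) *
  (1 + 2 * (p%:R `^ (s - 1))) ^+ (k - occ f p).
Proof.
move=> pp kp; have p0 : 0 < p%:R :> R by rewrite ltr0n prime_gt0.
have E1 : p%:R `^ s / p%:R = p%:R `^ (s - 1) :> R.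
  by rewrite -powR_inv1 ?(ltW p0) // -powRD ?(gt_eqF p0) ?implybT.
have E2 : p%:R `^ s / p%:R ^+ 2 = p%:R `^ (s - 2) :> R.
  by rewrite -powR_invn ?(ltW p0) // -powRD ?(gt_eqF p0) ?implybT.
have := ler_wpM2l (powR_ge0 p%:R s) (abs_fac_sub1_le R f pp kp).
rewrite mulrDr (_ : p%:R `^ s * (2 * _ / _) = (k - occ f p)%:R * (2 * (p%:R `^ s / p%:R))); last by ring.
rewrite (_ : p%:R `^ s * (_ / _) = k%:R ^+ 2 * (p%:R `^ s / p%:R ^+ 2)); last by ring.
rewrite E1 E2 => H.
set u := k%:R ^+ 2 * _ in H *; set t := 2 * _ in H *.
have u0 : 0 <= u by rewrite mulr_ge0 ?exprn_ge0 ?powR_ge0.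
have t0 : 0 <= t by rewrite mulr_ge0 ?powR_ge0.
have B := bernoulli_add (k - occ f p) t0.
have : (1 + u) * (1 + (k - occ f p)%:R * t) <= (1 + u) * (1 + t) ^+ (k - occ f p).
  by rewrite ler_wpM2l // addr_ge0.
apply: le_trans; have : 0 <= u * ((k - occ f p)%:R * t) by rewrite !mulr_ge0.
by lra.
Qed.

(* Rankin's trick: [1 <= (q_S / Q) ^ s] when [q_S > Q]. *)
Lemma rankin_tail_le (R : realType) (k h z N : nat) (f : {ffun 'I_k -> 'I_h})
  (Q s : R) : (0 < z)%N -> 0 <= s <= 1 / 2 -> 0 < Q ->
  4 * k%:R * (z%:R `^ (s - 1)) <= 1 ->
  \sum_(S : {set 'I_N} | (S \subset large_primes z N) && ~~ (\prod_(p in S) p%:R <= Q))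
    \prod_(p in S) `|fac R f p - 1|
  <= Q `^ (- s) * expR (2 * k%:R ^+ 2 * (z%:R `^ (s - 1))) *
     \prod_(p in large_primes z N) (1 + 2 * (p%:R `^ (s - 1))) ^+ (k - occ f p).
Proof.
move=> z0 /andP[s0 s2] Q0 kz; set X := large_primes z N.
have Xp (p : 'I_N) : p \in X -> prime p by rewrite inE => /andP[].
have Xz (p : 'I_N) : p \in X -> (z < p)%N by rewrite inE => /andP[].
apply: (@le_trans _ _ (\sum_(S : {set 'I_N} | S \subset X)
    Q `^ (- s) * \prod_(p in S) (p%:R `^ s * `|fac R f p - 1|))).
  rewrite big_mkcondr; apply: ler_sum => S SX.
  have P0 : 0 <= \prod_(p in S) `|fac R f p - 1| by apply: prodr_ge0.
  case: ifPn => [|_]; last first.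
    by rewrite mulr_ge0 ?powR_ge0 // prodr_ge0 // => p _; rewrite mulr_ge0 ?powR_ge0.
  rewrite -ltNge => QS; rewrite big_split /= mulrA ler_peMl //.
  have -> : \prod_(p in S) p%:R `^ s = (\prod_(p in S) p%:R) `^ s :> R.
    have [] : \prod_(p in S) p%:R `^ s = (\prod_(p in S) p%:R) `^ s :> R /\
        0 <= \prod_(p in S) p%:R :> R; last by [].
    apply: (big_rec2 (fun x y : R => x = y `^ s /\ 0 <= y)) => [|p x y _ [-> y0]].
      by rewrite powR1.
    by rewrite powRM // mulr_ge0.
  rewrite powRN mulrC ler_pdivlMr ?powR_gt0 // mul1r.
  by rewrite ge0_ler_powR ?nnegrE ?(ltW Q0) ?(ltW QS) // (le_trans (ltW Q0)) ?ltW.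
rewrite -mulr_sumr -prod_1add_subset -mulrA ler_wpM2l ?powR_ge0 //.
apply: (@le_trans _ _ (\prod_(p in X) ((1 + k%:R ^+ 2 * (p%:R `^ (s - 2))) *
   (1 + 2 * (p%:R `^ (s - 1))) ^+ (k - occ f p)))).
  apply: ler_prod => p pX; rewrite addr_ge0 ?mulr_ge0 ?powR_ge0 //=.
  apply: rankin_factor_le; first exact: Xp.
  by apply: (small_tuple_le_prime z0 _ kz); [lra|exact/ltnW/Xz].
rewrite big_split /= ler_wpM2r //.
  by apply: prodr_ge0 => p _; rewrite exprn_ge0 // addr_ge0 ?mulr_ge0 ?powR_ge0.
by apply: prod_1add_powR => //; rewrite exprn_ge0.
Qed.

(** The three error terms come from the products [q <= Q] averaged over all tuples, from removing
    the non-injective tuples there, and from the products [q > Q] over injective tuples. *)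
Lemma truncated_sum_dist_le (R : realType) (k h z N : nat) (Q s : R) :
  (0 < k)%N -> (0 < h)%N -> (0 < z)%N -> (z < N)%N ->
  0 <= s <= 1 / 2 -> 1 <= Q ->
  4 * k%:R * (z%:R `^ (s - 1)) <= 1 -> 2 * k%:R * z%:R ^+ z * Q <= h%:R ->
  `|\sum_(f : {ffun 'I_k -> 'I_h} | injectiveb f)
      \prod_(0 <= p < N | prime p) fac R f p - h%:R ^+ k| <=
  Q ^+ 2 * expR (4 * (z%:R `^ (s - 1))) *
    (h%:R ^+ k * (2 * k%:R * z%:R ^+ z * Q / h%:R)) +
  k%:R ^+ 2 * h%:R ^+ k.-1 * (z%:R ^+ k *
    (Q ^+ 2 * expR (4 * (z%:R `^ (s - 1))))) +
  z%:R ^+ k * (Q `^ (- s) * expR (2 * k%:R ^+ 2 * (z%:R `^ (s - 1)))) *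
    (k%:R * h%:R * (1 + h%:R * expR (8 * k%:R * (z%:R `^ (s - 1)))) ^+ k.-1).
Proof.
move=> k0 h0 z0 zN s02 Q1 kz zQ; set X := large_primes z N.
have Q0 : 0 < Q by apply: lt_le_trans Q1.
have Xp (p : 'I_N) : p \in X -> prime p by rewrite inE => /andP[].
have Xz (p : 'I_N) : p \in X -> (z < p)%N by rewrite inE => /andP[].
have s01 : 0 <= s <= 1 by move: s02 => /andP[? ?]; lra.
pose D (S : {set 'I_N}) := \prod_(p in S) p%:R <= Q.
pose W (f : {ffun 'I_k -> 'I_h}) := smooth_fac R f z.
pose a (f : {ffun 'I_k -> 'I_h}) (S : {set 'I_N}) := \prod_(p in S) (fac R f p - 1).
pose lo f := \sum_(S : {set 'I_N} | (S \subset X) && D S) a f S.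
pose hi f := \sum_(S : {set 'I_N} | (S \subset X) && ~~ D S) a f S.
have W0 f : 0 <= W f by apply: smooth_fac_ge0.
have Wz f : W f <= z%:R ^+ k by apply: prod_fac_le.
set E2 := Q ^+ 2 * expR _.
have small : \sum_(S : {set 'I_N} | (S \subset X) && D S) 2 ^+ #|S| <= E2.
  exact: sum_small_subsets.
have lohi f : \prod_(0 <= p < N | prime p) fac R f p = W f * lo f + W f * hi f.
  rewrite (prod_fac_split R f zN) prod_1add_subset -mulrDr; congr (_ * _).
  by rewrite (bigID D).
have low : `|\sum_f W f * lo f - h%:R ^+ k| <=
    E2 * (h%:R ^+ k * (2 * k%:R * z%:R ^+ z * Q / h%:R)).
  set e := h%:R ^+ k * (2 * _ * _ * _ / _).
  have e0 : 0 <= e by rewrite !mulr_ge0 ?exprn_ge0 ?invr_ge0 // ltW.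
  apply: le_trans (ler_wpM2r e0 small); rewrite mulr_suml.
  (* The main term belongs to the empty set, which is among the small sets because [1 <= Q]. *)
  have -> : h%:R ^+ k = \sum_(S : {set 'I_N} | (S \subset X) && D S)
      h%:R ^+ k * (S == set0)%:R :> R.
    rewrite (bigD1 set0) /=; last by rewrite sub0set /D big_set0.
    by rewrite eqxx mulr1 big1 ?addr0 // => S /andP[_ /negbTE ->]; rewrite mulr0.
  rewrite (eq_bigr (fun f => \sum_(S : {set 'I_N} | (S \subset X) && D S) W f * a f S)); last first.
    by move=> f _; rewrite mulr_sumr.
  rewrite exchange_big /= -sumrB; apply: (le_trans (ler_norm_sum _ _ _)).
  by apply: ler_sum => S /andP[SX SD]; apply: mean_large_fac.
(* Non-injective tuples are few, so trivial bounds suffice: [W f <= z ^ k] and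
   [|a f S| <= 2 ^ #|S|]. *)
have non : `|\sum_(f : {ffun 'I_k -> 'I_h} | ~~ injectiveb f) W f * lo f| <=
    k%:R ^+ 2 * h%:R ^+ k.-1 * (z%:R ^+ k * E2).
  apply: (le_trans (ler_norm_sum _ _ _)).
  have zE : 0 <= z%:R ^+ k * E2 by rewrite !mulr_ge0 ?exprn_ge0 ?expR_ge0 // ltW.
  apply: (@le_trans _ _ (\sum_(f : {ffun 'I_k -> 'I_h} | ~~ injectiveb f) z%:R ^+ k * E2)).
    apply: ler_sum => f _; rewrite normrM ger0_norm // ler_pM //.
    apply: le_trans small; apply: (le_trans (ler_norm_sum _ _ _)).
    apply: ler_sum => S /andP[SX _]; rewrite normr_prod -prodr_const.
    apply: ler_prod => p /(subsetP SX) pX; rewrite normr_ge0 /=.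
    apply: abs_fac_sub1_le2; first exact: Xp.
    by apply: (small_tuple_le_prime z0 s01 kz); exact/ltnW/Xz.
  rewrite (eq_bigl (fun f => f \in [set f : {ffun 'I_k -> 'I_h} | ~~ injectiveb f]%SET)); last first.
    by move=> f; rewrite inE.
  rewrite sumr_const -[leLHS]mulr_natl ler_wpM2r //.
  by rewrite -!natrX -natrM ler_nat card_noninjective.
have high : `|\sum_(f : {ffun 'I_k -> 'I_h} | injectiveb f) W f * hi f| <=
    z%:R ^+ k * (Q `^ (- s) * expR (2 * k%:R ^+ 2 * (z%:R `^ (s - 1)))) *
    (k%:R * h%:R * (1 + h%:R * expR (8 * k%:R * (z%:R `^ (s - 1)))) ^+ k.-1).
  have s2 : s <= 1 / 2 by case/andP: s02.
  have e0 : 0 <= z%:R ^+ k * (Q `^ (- s) * expR (2 * k%:R ^+ 2 * (z%:R `^ (s - 1)))).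
    by rewrite !mulr_ge0 ?exprn_ge0 ?powR_ge0 ?expR_ge0.
  apply: le_trans (ler_wpM2l e0 (sum_prod_collisions_le h N k0 z0 s2 kz)).
  apply: (le_trans (ler_norm_sum _ _ _)); rewrite mulr_sumr; apply: ler_sum => f _.
  rewrite normrM ger0_norm // -[leRHS]mulrA ler_pM //.
  apply: le_trans (rankin_tail_le N f z0 s02 Q0 kz).
  apply: (le_trans (ler_norm_sum _ _ _)).
  by apply: ler_sum => S _; rewrite normr_prod.
rewrite (eq_bigr _ (fun f _ => lohi f)) big_split /=.
have -> : \sum_(f : {ffun 'I_k -> 'I_h} | injectiveb f) W f * lo f =
    \sum_f W f * lo f - \sum_(f : {ffun 'I_k -> 'I_h} | ~~ injectiveb f) W f * lo f.
  by rewrite [X in _ = X - _](bigID (fun f : {ffun 'I_k -> 'I_h} => injectiveb f)) /= addrK.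
rewrite (_ : _ - _ = (\sum_f W f * lo f - h%:R ^+ k) -
  \sum_(f : {ffun 'I_k -> 'I_h} | ~~ injectiveb f) W f * lo f + \sum_(f : {ffun 'I_k -> 'I_h} | injectiveb f) W f * hi f); last by ring.
apply: (le_trans (ler_normD _ _)); apply: lerD => //.
by apply: (le_trans (ler_normB _ _)); apply: lerD.
Qed.

(** * Choice of parameters *)

Lemma T_dist_powR_le (R : realType) (k h z : nat) (s : R) :
  (0 < k)%N -> (0 < h)%N -> (0 < z)%N -> 0 < s <= 1 / 8 ->
  z%:R * ln z%:R <= s / 40 * ln (h%:R : R) -> z%:R <= s / 40 * ln (h%:R : R) ->
  1 <= s / 40 * ln (h%:R : R) ->
  4 * k%:R * (z%:R `^ (s - 1)) <= 1 ->
  `|T R k h - h%:R ^+ k| <= 3 * h%:R `^ (k%:R - s / 8).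
Proof.
move=> k0 h0 z0 /andP[s0 s8]; set L := ln (h%:R : R); set e := s / 40.
move=> zlnz zL eL kz.
have hR : 0 < h%:R :> R by rewrite ltr0n.
have e0 : 0 < e by rewrite /e; lra.
have L0 : 0 < L by rewrite -(pmulr_rgt0 _ e0); lra.
have sL : s * L <= 1 / 8 * L by rewrite ler_pM2r.
have eE : e * L = (s * L) / 40 by rewrite /e; ring.
have hE : h%:R = expR L :> R by rewrite lnK.
have h1 : 1 <= h%:R :> R by rewrite hE -expR0 ler_expR ltW.
have hX n : h%:R ^+ n = expR (n%:R * L) by rewrite expRM_natl -hE.
have hP x : h%:R `^ x = expR (x * L) by rewrite /powR gt_eqF.
(* [B = h ^ (s / 40)] will absorb [z ^ z], [z ^ k], [2 k] and the exponentials. *)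
set B := expR (e * L); set w := z%:R `^ (s - 1).
have w0 : 0 <= w by apply: powR_ge0.
have k1 : 1 <= k%:R :> R by rewrite ler1n.
have k2z : (2 * k <= z)%N by apply: (small_tuple_le_prime z0 _ kz) => //; lra.
have k2zR : 2 * k%:R <= z%:R :> R by rewrite -natrM ler_nat.
have z1 : 1 <= z%:R :> R by rewrite ler1n.
have zz : z%:R ^+ z <= B :> R.
  by rewrite -[X in X ^+ _]lnK ?posrE ?ltr0n // -expRM_natl ler_expR.
have kz' : (k <= z)%N by apply: leq_trans k2z; rewrite leq_pmull.
have zk : z%:R ^+ k <= B :> R by apply: le_trans zz; exact: ler_weXn2l.
have zB : z%:R <= B :> R.
  apply: (@le_trans _ _ (expR z%:R)); last by rewrite ler_expR.
  by have := expR_ge1Dx (z%:R : R); lra.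
have kB : 2 * k%:R <= B :> R by apply: le_trans zB.
have kw : k%:R * w <= 1 / 4 by move: kz; rewrite -/w; lra.
have w4 : w <= 1 / 4 by apply: le_trans kw; rewrite ler_peMl.
have ew : expR (4 * w) <= B by rewrite ler_expR; lra.
have ek : expR (2 * k%:R ^+ 2 * w) <= B.
  rewrite ler_expR; have := ler_wpM2l (ler0n R k) kw; rewrite expr2; lra.
(* [Q = h ^ (1 / 4)]: the first two errors contain at most [Q ^ 3 / h], while Rankin's factor
   [Q ^ (-s)] saves [h ^ (-s / 4)]. *)
pose Q := expR (L / 4).
have Q1 : 1 <= Q by rewrite -expR0 ler_expR divr_ge0 // ltW.
have Qs : Q `^ (- s) = expR (- (s * L) / 4).
  by rewrite /Q -expRM; congr expR; ring.
(* The factor [exp 3] to the power [k - 1] is at most [B ^ 2], because [2 k <= z <= s / 40 * L]. *)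
have G : (1 + h%:R * expR (8 * k%:R * w)) ^+ k.-1 <= h%:R ^+ k.-1 * (B * B).
  have G1 : 1 + h%:R * expR (8 * k%:R * w) <= h%:R * expR 3.
    have E2 : expR (8 * k%:R * w) <= expR 2 by rewrite ler_expR; lra.
    have E3 : 2 * expR 2 <= expR 3 :> R.
      rewrite (_ : 3 = 1 + 2) ?expRD; last by ring.
      by rewrite ler_pM2r ?expR_gt0 //; have := expR_ge1Dx (1 : R); lra.
    have E1 : 1 <= expR 2 :> R by rewrite -expR0 ler_expR.
    apply: (@le_trans _ _ (h%:R * (1 + expR 2))); last by rewrite ler_wpM2l //; lra.
    by rewrite mulrDr mulr1 lerD // ler_wpM2l.
  apply: (@le_trans _ _ ((h%:R * expR 3) ^+ k.-1)).
    by rewrite lerXn2r ?nnegrE ?addr_ge0 ?mulr_ge0 ?expR_ge0.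
  rewrite exprMn ler_wpM2l ?exprn_ge0 // -expRM_natl -expRD ler_expR.
  have : k.-1%:R <= k%:R :> R by rewrite ler_nat leq_pred.
  by lra.
have kk : k%:R * L = L + k.-1%:R * L.
  by rewrite -[in LHS](prednK k0) -natr1 mulrDl mul1r addrC.
apply: (@T_dist_le R k h z.+1) => N zN.
have cond : 2 * k%:R * z%:R ^+ z * Q <= h%:R.
  apply: (@le_trans _ _ (B * B * Q)).
    by rewrite ler_wpM2r ?expR_ge0 // ler_pM ?mulr_ge0 ?exprn_ge0.
  by rewrite hE /B /Q -!expRD ler_expR; lra.
have s02 : 0 <= s <= 1 / 2 by lra.
apply: le_trans (truncated_sum_dist_le k0 h0 z0 zN s02 Q1 kz cond) _.
rewrite -/w; set X := h%:R `^ _.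
have {}hk1 : h%:R ^+ k.-1 * h%:R = h%:R ^+ k :> R by rewrite -exprSr prednK.
have T1 : Q ^+ 2 * expR (4 * w) * (h%:R ^+ k * (2 * k%:R * z%:R ^+ z * Q / h%:R)) <= X.
  apply: (@le_trans _ _ (Q ^+ 2 * B * (h%:R ^+ k * (B * B * Q / h%:R)))).
    rewrite ler_pM ?mulr_ge0 ?exprn_ge0 ?expR_ge0 ?invr_ge0 ?ler_wpM2l ?exprn_ge0 ?expR_ge0 //.
    rewrite ler_wpM2r ?invr_ge0 // ler_wpM2r ?expR_ge0 //.
    by rewrite ler_pM ?mulr_ge0 ?exprn_ge0.
  rewrite /X hX hP hE -expRN /B /Q -expRM_natl -!expRD ler_expR; lra.
have T2 : k%:R ^+ 2 * h%:R ^+ k.-1 * (z%:R ^+ k * (Q ^+ 2 * expR (4 * w))) <= X.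
  apply: (@le_trans _ _ (B ^+ 2 * h%:R ^+ k.-1 * (B * (Q ^+ 2 * B)))).
    apply: ler_pM; rewrite ?mulr_ge0 ?exprn_ge0 ?expR_ge0 //.
      rewrite ler_wpM2r ?exprn_ge0 // lerXn2r ?nnegrE ?expR_ge0 //; lra.
    by apply: ler_pM; rewrite ?mulr_ge0 ?exprn_ge0 ?expR_ge0 ?ler_wpM2l ?exprn_ge0 ?expR_ge0.
  rewrite /X hX hP /B /Q -!expRM_natl -!expRD ler_expR; lra.
(* Five factors [B] cost [h ^ (s / 8)] against the saving [h ^ (-s / 4)]; this fixes both the
   constant 40 and the final exponent [s / 8]. *)
have T3 : z%:R ^+ k * (Q `^ (- s) * expR (2 * k%:R ^+ 2 * w)) *
    (k%:R * h%:R * (1 + h%:R * expR (8 * k%:R * w)) ^+ k.-1) <= X.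
  apply: (@le_trans _ _ (B * (Q `^ (- s) * B) * (B * h%:R * (h%:R ^+ k.-1 * (B * B))))).
    apply: ler_pM; rewrite ?mulr_ge0 ?exprn_ge0 ?addr_ge0 ?mulr_ge0 ?expR_ge0 ?powR_ge0 //.
      by apply: ler_pM; rewrite ?mulr_ge0 ?exprn_ge0 ?expR_ge0 ?powR_ge0 ?ler_wpM2l ?powR_ge0.
    apply: ler_pM; rewrite ?mulr_ge0 ?exprn_ge0 ?addr_ge0 ?mulr_ge0 ?expR_ge0 //.
    by rewrite ler_wpM2r //; lra.
  rewrite /X Qs hX hP hE /B -!expRD ler_expR; lra.
by lra.
Qed.

(* [t ln x <= x ^ t], with [t = s / 2]. *)
Lemma xlnx_le_powR (R : realType) (s x : R) : 0 < s -> 0 < x ->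
  x * ln x <= 2 / s * x `^ (1 + s / 2).
Proof.
move=> s0 x0; have := ln_sublinear (powR_gt0 (s / 2) x0); rewrite ln_powR => H.
have -> : x `^ (1 + s / 2) = x * x `^ (s / 2).
  by rewrite powRD ?powRr1 ?(ltW x0) // (gt_eqF x0) implybT.
rewrite mulrCA ler_pM2l //.
have -> : ln x = 2 / s * (s / 2 * ln x) by field; rewrite gt_eqF.
by rewrite ler_wpM2l ?(ltW H) // divr_ge0 // ltW.
Qed.

(** Here [L] stands for [ln h], and [z] is [L ^ (1 - s)] rounded up. The threshold on [L] means that
    [L ^ (s / 2)] exceeds both [320 / s ^ 2], which makes [z ln z] small against [L], and [4 A],
    which handles [k]. *)
Lemma sieve_level_exists (R : realType) (s A L : R) : 0 < s <= 1 / 8 -> 0 < A ->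
  (320 / s ^+ 2 + 4 * A) `^ (2 / s) <= L ->
  1 <= L /\ exists z : nat, [/\ (0 < z)%N, z%:R * ln z%:R <= s / 40 * L,
    z%:R <= s / 40 * L, 1 <= s / 40 * L &
    forall k : nat, k%:R <= A * L `^ (1 - 4 * s) ->
      4 * k%:R * (z%:R `^ (s - 1)) <= 1].
Proof.
move=> /andP[s0 s8] A0; set K := _ + _ => KL.
have s2 : 0 < s ^+ 2 by rewrite exprn_gt0.
have K320 : 320 / s ^+ 2 <= K by rewrite lerDl; lra.
have KA : 4 * A <= K by rewrite lerDr divr_ge0 ?ler0n ?(ltW s2).
have K1 : 320 / s <= K.
  apply: le_trans K320; rewrite ler_wpM2l ?ler0n // lef_pV2 ?posrE // expr2.
  by rewrite ler_piMl ?(ltW s0) //; lra.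
have K0 : 1 <= K.
  by apply: le_trans K1; rewrite ler_pdivlMr //; lra.
have L1 : 1 <= L.
  apply: le_trans KL; rewrite -[leLHS](powRr0 K).
  by apply: (ler_powR K0); rewrite divr_ge0 // ltW.
have L0 : 0 < L by apply: lt_le_trans L1.
have KL2 : K <= L `^ (s / 2).
  apply: (@le_trans _ _ ((K `^ (2 / s)) `^ (s / 2))).
    rewrite -powRrM (_ : 2 / s * (s / 2) = 1); last by field; rewrite gt_eqF.
    by rewrite powRr1 // (le_trans ler01).
  by rewrite ge0_ler_powR ?nnegrE ?powR_ge0 ?(ltW L0) ?divr_ge0 ?(ltW s0).
have LX x y : L `^ (x + y) = L `^ x * L `^ y by rewrite powRD // (gt_eqF L0) implybT.
have LL x y : x <= y -> L `^ x <= L `^ y by move=> xy; rewrite ler_powR.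
split=> //; pose z := (Num.truncn (L `^ (1 - s))).+1; exists z.
have M1 : 1 <= L `^ (1 - s) by rewrite -[leLHS](powRr0 L); apply: LL; lra.
have zlo : L `^ (1 - s) <= z%:R by apply/ltW/truncnS_gt.
have zhi : z%:R <= 2 * L `^ (1 - s).
  rewrite /z -natr1; have := truncn_le (L `^ (1 - s)); rewrite powR_ge0; lra.
have z1 : 1 <= z%:R :> R by rewrite ler1n.
have z0 : 0 < z%:R :> R by lra.
have big : 8 / s * L `^ (1 - s / 2) <= s / 40 * L.
  have -> : s / 40 * L = L `^ (1 - s / 2) * (s / 40 * L `^ (s / 2)).
    rewrite mulrCA -LX (_ : 1 - s / 2 + s / 2 = 1) ?powRr1 ?(ltW L0) //; ring.
  rewrite mulrC ler_wpM2l ?powR_ge0 //.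
  have -> : 8 / s = s / 40 * (320 / s ^+ 2) by field; rewrite gt_eqF.
  by rewrite ler_wpM2l ?(le_trans K320) // divr_ge0 // ltW.
have s8' : 8 <= 8 / s by rewrite ler_pdivlMr //; lra.
have zz : 2 * L `^ (1 - s) <= 8 / s * L `^ (1 - s / 2).
  by rewrite ler_pM ?powR_ge0 //; [lra|apply: LL; lra].
have zs : z%:R <= s / 40 * L by lra.
split => //.
(* Use [(1 - s) (1 + s / 2) <= 1 - s / 2], and [2 ^ (1 + s / 2) <= 4] for the factor 2 lost in
   rounding. *)
- apply: le_trans big; apply: le_trans (xlnx_le_powR s0 z0) _.
  have -> : 8 / s * L `^ (1 - s / 2) = 2 / s * (4 * L `^ (1 - s / 2)) by ring.
  rewrite ler_wpM2l ?divr_ge0 ?(ltW s0) //.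
  apply: (@le_trans _ _ ((2 * L `^ (1 - s)) `^ (1 + s / 2))).
    by rewrite ge0_ler_powR ?nnegrE ?(ltW z0) ?mulr_ge0 ?powR_ge0 //; lra.
  rewrite powRM ?powR_ge0 // -powRrM; apply: ler_pM; rewrite ?powR_ge0 //.
    rewrite (_ : 4 = 2 `^ 2%:R) ?ler_powR //; [lra|lra|].
    by rewrite powR_mulrn // -natrX.
  by apply: LL; have := mulr_gt0 s0 s0; lra.
- by lra.
move=> k kA.
(* Since [(1 - s) ^ 2 >= 1 - 2 s], multiplying by [k <= A L ^ (1 - 4 s)] leaves [A L ^ (- 2 s)]. *)
have wle : z%:R `^ (s - 1) <= L `^ (2 * s - 1).
  rewrite -(opprB 1 s) -(opprB 1 (2 * s)) !powRN lef_pV2 ?posrE ?powR_gt0 //.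
  apply: (@le_trans _ _ ((L `^ (1 - s)) `^ (1 - s))).
    by rewrite -powRrM; apply: LL; have := mulr_gt0 s0 s0; lra.
  by rewrite ge0_ler_powR ?nnegrE ?powR_ge0 ?(ltW z0) //; lra.
have L2s : 4 * A <= L `^ (2 * s).
  by apply: (le_trans KA); apply: (le_trans KL2); apply: LL; lra.
apply: (@le_trans _ _ (4 * (A * L `^ (1 - 4 * s)) * L `^ (2 * s - 1))).
  by rewrite ler_pM ?powR_ge0 ?mulr_ge0 // ler_wpM2l.
rewrite mulrA -mulrA -LX (_ : 1 - 4 * s + (2 * s - 1) = - (2 * s)); last by ring.
by rewrite powRN ler_pdivrMr ?powR_gt0 // mul1r.
Qed.

Theorem theorem1p1 (R : realType) (delta : R) (delta_gt0 : 0 < delta) :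
  exists2 beta : R, 0 < beta &
  forall A : R, 0 < A ->
  exists (C : R) (h0 : nat), forall h k : nat,
    (h0 <= h)%N -> (0 < k)%N ->
    k%:R <= A * ln (h%:R : R) `^ (1 - delta) ->
    `|T R k h - h%:R ^+ k| <= C * h%:R `^ (k%:R - beta).
Proof.
(* This gives [4 s <= delta] and [s <= 1 / 8], so for [ln h >= 1] the bound on [k] implies the one
   with exponent [1 - 4 s]; [s] depends on [delta] alone. *)
pose s := Num.min delta (1 / 2) / 4.
have s0 : 0 < s by rewrite divr_gt0 // lt_min delta_gt0 /=; lra.
have sd : 4 * s <= delta by rewrite /s mulrCA divff // mulr1 ge_min lexx.
have s8 : 0 < s <= 1 / 8.
  rewrite s0 /= /s; have : Num.min delta (1 / 2) <= 1 / 2 by rewrite ge_min lexx orbT.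
  by lra.
exists (s / 8) => [|A A0]; first by rewrite divr_gt0.
pose L0 := (320 / s ^+ 2 + 4 * A) `^ (2 / s).
(* The threshold forces [ln h >= L0]; only it depends on [A]. *)
exists 3, (Num.truncn (expR L0)).+1 => h k hh k0 kA.
have hL : expR L0 <= h%:R.
  by apply: le_trans (ltW (truncnS_gt _)) _; rewrite ler_nat.
have h0 : (0 < h)%N by lia.
have LL : L0 <= ln (h%:R : R) by rewrite -[L0]expRK ler_ln ?posrE ?expR_gt0 ?ltr0n.
have [L1 [z [z0 zlnz zL eL kz]]] := sieve_level_exists s8 A0 LL.
apply: (T_dist_powR_le k0 h0 z0 s8 zlnz zL eL); apply: kz.
apply: (le_trans kA); rewrite ler_wpM2l ?(ltW A0) // ler_powR //.
by lra.
Qed.
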